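(* Let $1\le p<\infty$, let $(X,\mathcal B,\mu)$ be a $\sigma$-finite measure space such that $L^p(X)=L^p(X,\mathcal B,\mu)$ is separable, and let $T_f:L^p(X)\to L^p(X)$, $T_f(\varphi)=\varphi\circ f$, be a dissipative composition operator of bounded distortion. Then $T_f$ is frequently recurrent if and only if $T_f$ is frequently hypercyclic.
   Context: Composition operator: let $(X,\mathcal B,\mu)$ be a $\sigma$-finite measure space and $f:X\to X$ a bijective bimeasurable map (both $f$ and $f^{-1}$ are measurable) such that both $f$ and $f^{-1}$ satisfy the following condition: for $g=f$ and for $g=f^{-1}$ there is a constant $c_g>0$ with $\mu(g^{-1}(B))\le c_g\,\mu(B)$ for every $B\in\mathcal B$. For $1\le p<\infty$ the composition operator induced by $f$ is the bounded linear operator $T_f:L^p(X)\to L^p(X)$, $\varphi\mapsto\varphi\circ f$; it is invertible with $T_f^{-1}=T_{f^{-1}}$. Dissipative of bounded distortion: $T_f$ is dissipative if there exists $W\in\mathcal B$ with $0<\mu(W)<\infty$ such that $X=\dot\bigcup_{k\in\mathbb Z}f^k(W)$ (disjoint union). It is dissipative of bounded distortion if, in addition, there exists $K>0$ such that $$\frac1K\,\mu(f^k(W))\,\mu(B)\le \mu(f^k(B))\,\mu(W)\le K\,\mu(f^k(W))\,\mu(B)$$ for every $k\in\mathbb Z$ and every $B\in\mathcal B(W)=\{B'\cap W: B'\in\mathcal B\}$. Let $T:E\to E$ be a bounded linear operator on a separable Banach space $E$. A vector $x\in E$ is frequently recurrent for $T$ if for every neighborhood $U$ of $x$, $\liminf_{N\to\infty}\frac1N\#\{1\le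 n\le N: T^n x\in U\}>0$. The operator $T$ is frequently recurrent if its set of frequently recurrent vectors is dense in $E$. The operator $T$ is frequently hypercyclic if there is $x\in E$ such that for every non-empty open set $U\subseteq E$, $\liminf_{N\to\infty}\frac1N\#\{1\le n\le N: T^n x\in U\}>0$. *)

(* Defs.v *)
From HB Require Import structures.
From mathcomp Require Import all_boot all_order all_algebra.
From mathcomp Require Import all_classical all_reals all_analysis.
From mathcomp Require Import measurable_realfun ess_sup_inf complex.

Set Implicit Arguments.
Unset Strict Implicit.
Unset Printing Implicit Defensive.

Import Order.TTheory GRing.Theory Num.Theory.
Import numFieldNormedType.Exports.

Local Open Scope classical_set_scope.
Local Open Scope ring_scope.

(* The Banach spaces are taken over K = R or K = C; a statement quantified over
   [s : scalars] covers both real- and complex-valued L^p. *)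
Variant scalars := RealScalars | ComplexScalars.

Definition scalar_field (R : realType) (s : scalars) : numFieldType :=
  match s with
  | RealScalars => R
  | ComplexScalars => (R[i] : numFieldType)
  end.

Section Scalars.
Variables (R : realType) (s : scalars).
Local Notation K := (scalar_field R s).

Definition scalar_re : K -> R :=
  match s return scalar_field R s -> R with
  | RealScalars => fun x => x
  | ComplexScalars => fun z => complex.Re z
  end.

Definition scalar_im : K -> R :=
  match s return scalar_field R s -> R with
  | RealScalars => fun=> 0
  | ComplexScalars => fun z => complex.Im z
  end.

Definition scalar_abs : K -> R :=
  match s return scalar_field R s -> R with
  | RealScalars => fun x => `|x|
  | ComplexScalars => fun z => Normc.normc z
  end.

Definition scalar_of_real : R -> K :=
  match s return R -> scalar_field R s with
  | RealScalars => fun x => x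
  | ComplexScalars => fun x => (x%:C)%C
  end.

Lemma scalar_absE (z : K) : `|z| = scalar_of_real (scalar_abs z).
Proof. by rewrite /scalar_abs /scalar_of_real; case: s z => //= -[]. Qed.

Lemma scalar_abs_sqrt (z : K) :
  scalar_abs z = Num.sqrt (scalar_re z ^+ 2 + scalar_im z ^+ 2).
Proof.
rewrite /scalar_abs /scalar_re /scalar_im; case: s z => [x|[a b]] //=.
by rewrite expr0n/= addr0 sqrtr_sqr.
Qed.

Lemma scalar_reD (x y : K) : scalar_re (x + y) = scalar_re x + scalar_re y.
Proof. by rewrite /scalar_re; case: s x y => [x y|[a b] [c d]]. Qed.

Lemma scalar_imD (x y : K) : scalar_im (x + y) = scalar_im x + scalar_im y.
Proof. by rewrite /scalar_im; case: s x y => [x y|[a b] [c d]] //=; rewrite addr0. Qed.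

Lemma scalar_reM (x y : K) :
  scalar_re (x * y) = scalar_re x * scalar_re y - scalar_im x * scalar_im y.
Proof.
rewrite /scalar_re /scalar_im; case: s x y => [x y|[a b] [c d]] //=.
by rewrite mul0r subr0.
Qed.

Lemma scalar_imM (x y : K) :
  scalar_im (x * y) = scalar_re x * scalar_im y + scalar_im x * scalar_re y.
Proof.
rewrite /scalar_re /scalar_im; case: s x y => [x y|[a b] [c d]] //=.
by rewrite mulr0 mul0r addr0.
Qed.

Lemma scalar_re0 : scalar_re 0 = 0.
Proof. by rewrite /scalar_re; case: s. Qed.

Lemma scalar_im0 : scalar_im 0 = 0.
Proof. by rewrite /scalar_im; case: s. Qed.

Lemma scalar_abs_ge0 (z : K) : 0 <= scalar_abs z.
Proof. by rewrite scalar_abs_sqrt sqrtr_ge0. Qed.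

Lemma scalar_abs0 : scalar_abs 0 = 0.
Proof. by rewrite scalar_abs_sqrt scalar_re0 scalar_im0 expr0n/= addr0 sqrtr0. Qed.

Lemma scalar_abs_eq0 (z : K) : scalar_abs z = 0 -> z = 0.
Proof.
rewrite /scalar_abs; case: s z => [x /normr0_eq0|z /Normc.eq0_normc] //.
Qed.

Lemma scalar_absD (x y : K) : scalar_abs (x + y) <= scalar_abs x + scalar_abs y.
Proof.
by rewrite /scalar_abs; case: s x y => [x y|x y]; [exact: ler_normD|exact: le_normcD].
Qed.

Lemma scalar_absM (x y : K) : scalar_abs (x * y) = scalar_abs x * scalar_abs y.
Proof.
by rewrite /scalar_abs; case: s x y => [x y|x y]; [exact: normrM|exact: Normc.normcM].
Qed.

Lemma scalar_of_realD x y :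
  scalar_of_real (x + y) = scalar_of_real x + scalar_of_real y.
Proof. by rewrite /scalar_of_real; case: s => //; exact: rmorphD. Qed.

Lemma scalar_of_realM x y :
  scalar_of_real (x * y) = scalar_of_real x * scalar_of_real y.
Proof. by rewrite /scalar_of_real; case: s => //; exact: rmorphM. Qed.

Lemma scalar_of_real_le x y : (scalar_of_real x <= scalar_of_real y) = (x <= y).
Proof. by rewrite /scalar_of_real; case: s => //=; rewrite lecR. Qed.

Lemma scalar_of_real_inj : injective scalar_of_real.
Proof. by rewrite /scalar_of_real; case: s => // x y []. Qed.

Lemma scalar_of_real0 : scalar_of_real 0 = 0.
Proof. by rewrite /scalar_of_real; case: s. Qed.

End Scalars.


Section Lnorm_extra.
Context d (X : measurableType d) (R : realType).
Variable mu : {measure set X -> \bar R}.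
Local Open Scope ereal_scope.

Lemma measurable_abs_powR (p : R) (f : X -> R) : measurable_fun setT f ->
  measurable_fun setT (fun x => `|(EFin \o f) x| `^ p).
Proof.
move=> mf; rewrite (_ : (fun _ => _) = (EFin \o (fun x => `|f x| `^ p)%R)) //.
apply: measurableT_comp => //; apply: (measurableT_comp (measurable_powR p)).
exact: measurableT_comp.
Qed.

Lemma le_Lnorm (p : R) (f g : X -> R) : (0 < p)%R ->
  measurable_fun setT f -> measurable_fun setT g ->
  (forall x, 0 <= f x)%R -> (forall x, f x <= g x)%R ->
  'N[mu]_p%:E[EFin \o f] <= 'N[mu]_p%:E[EFin \o g].
Proof.
move=> p0 mf mg f0 fg; rewrite unlock /Lnorm.
rewrite gt0_ler_poweR ?invr_ge0 ?(ltW p0)//.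
- by rewrite in_itv/= leey integral_ge0.
- by rewrite in_itv/= leey integral_ge0.
rewrite ge0_le_integral//.
- by move=> x _; exact: poweR_ge0.
- exact: measurable_abs_powR.
- exact: measurable_abs_powR.
move=> x _ /=; rewrite lee_fin ge0_ler_powR ?(ltW p0) ?nnegrE//.
by rewrite !ger0_norm// (le_trans (f0 x)).
Qed.

Lemma Lnorm_comp_le (p c : R) (T : X -> X) (f : X -> R) : (0 < p)%R ->
  (0 <= c)%R -> measurable_fun setT T -> measurable_fun setT f ->
  (forall B, measurable B -> mu (T @^-1` B) <= c%:E * mu B) ->
  'N[mu]_p%:E[EFin \o (f \o T)] <= (c `^ p^-1)%:E * 'N[mu]_p%:E[EFin \o f].
Proof.
move=> p0 c0 mT mf muT; rewrite unlock /Lnorm.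
have mfp := measurable_abs_powR p mf.
rewrite -poweR_EFin -poweRM ?integral_ge0//.
rewrite gt0_ler_poweR ?invr_ge0 ?(ltW p0)//.
- by rewrite in_itv/= leey integral_ge0.
- by rewrite in_itv/= leey mule_ge0 ?integral_ge0.
have := @ge0_integral_pushforward _ _ _ _ R _ mT mu setT _ measurableT mfp.
rewrite preimage_setT => /(_ _)/esym -> //.
pose mT_ := isMeasurableFun.Build _ _ _ _ _ mT.
pose T_ : {mfun X >-> X} := HB.pack T mT_.
have := @ge0_integral_mscale _ _ R mu setT measurableT (NngNum c0) _ mfp.
move=> /(_ _) <- //.
by apply: (@ge0_le_measure_integral _ _ _ (pushforward mu T_)
  (mscale (NngNum c0) mu)) => // *; exact: poweR_ge0.
all: by move=> *; exact: poweR_ge0.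
Qed.

End Lnorm_extra.

Section LpFunctions.
Context (R : realType) (s : scalars) d (X : measurableType d).
Variables (mu : {measure set X -> \bar R}) (p : R) (p1 : 1 <= p).
Local Notation K := (scalar_field R s).

Definition scalar_measurable (phi : X -> K) : Prop :=
  measurable_fun [set: X] (@scalar_re R s \o phi) /\
  measurable_fun [set: X] (@scalar_im R s \o phi).

Definition eLp_norm (phi : X -> K) : \bar R :=
  'N[mu]_p%:E[EFin \o (@scalar_abs R s \o phi)].

(* The otherwise unused proof of 1 <= p lets the module structures on Lp_fun and
   Lp below be inferred from the type alone. *)
Definition Lp_fun_pred of 1 <= p : {pred X -> K} :=
  fun phi => `[< scalar_measurable phi /\ (eLp_norm phi < +oo)%E >].

Let p0 : 0 < p. Proof. exact: lt_le_trans p1. Qed.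

Lemma scalar_measurable_abs phi :
  scalar_measurable phi -> measurable_fun setT (@scalar_abs R s \o phi).
Proof.
move=> [mre mim]; rewrite (_ : _ \o _ = Num.sqrt \o
  ((fun x => scalar_re (phi x) ^+ 2) \+ (fun x => scalar_im (phi x) ^+ 2)));
  last first.
  by apply/funext => x /=; rewrite scalar_abs_sqrt.
apply: measurableT_comp; first by apply: continuous_measurable_fun; exact: sqrt_continuous.
by apply: measurable_funD; exact: measurable_funX.
Qed.

Lemma scalar_measurable_comp phi T : measurable_fun setT T ->
  scalar_measurable phi -> scalar_measurable (phi \o T).
Proof.
by move=> mT [mre mim]; split;
  [apply: (measurableT_comp mre mT)|apply: (measurableT_comp mim mT)].
Qed.

Lemma scalar_measurableD phi psi : scalar_measurable phi ->
  scalar_measurable psi -> scalar_measurable (phi + psi).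
Proof.
move=> [mr mi] [nr ni]; split.
- rewrite (_ : _ \o _ = (@scalar_re R s \o phi) \+ (@scalar_re R s \o psi)).
    exact: measurable_funD.
  by apply/funext => x /=; rewrite scalar_reD.
- rewrite (_ : _ \o _ = (@scalar_im R s \o phi) \+ (@scalar_im R s \o psi)).
    exact: measurable_funD.
  by apply/funext => x /=; rewrite scalar_imD.
Qed.

Lemma scalar_measurableZ (a : K) phi : scalar_measurable phi ->
  scalar_measurable (a *: phi).
Proof.
move=> [mr mi]; split.
- rewrite (_ : _ \o _ = (cst (scalar_re a) \* (@scalar_re R s \o phi)) \-
    (cst (scalar_im a) \* (@scalar_im R s \o phi))).
    by apply: measurable_funB; exact: measurable_funM.
  by apply/funext => x /=; exact: scalar_reM.
- rewrite (_ : _ \o _ = (cst (scalar_re a) \* (@scalar_im R s \o phi)) \+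
    (cst (scalar_im a) \* (@scalar_re R s \o phi))).
    by apply: measurable_funD; exact: measurable_funM.
  by apply/funext => x /=; exact: scalar_imM.
Qed.

Lemma scalar_measurable0 : scalar_measurable 0.
Proof.
split.
- rewrite (_ : _ \o _ = cst 0)//.
  by apply/funext => x /=; rewrite scalar_re0.
- rewrite (_ : _ \o _ = cst 0)//.
  by apply/funext => x /=; rewrite scalar_im0.
Qed.

Lemma eLp_norm_ge0 phi : (0 <= eLp_norm phi)%E.
Proof. exact: Lnorm_ge0. Qed.

Lemma eLp_norm0 : eLp_norm 0 = 0%E.
Proof.
rewrite /eLp_norm (_ : EFin \o _ = cst 0%E).
  by rewrite Lnorm0// eqe gt_eqF.
by apply/funext => x /=; rewrite scalar_abs0.
Qed.

Lemma eLp_normD phi psi : scalar_measurable phi -> scalar_measurable psi ->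
  (eLp_norm (phi + psi)%R <= eLp_norm phi + eLp_norm psi)%E.
Proof.
move=> mphi mpsi; have ma := scalar_measurable_abs mphi.
have mb := scalar_measurable_abs mpsi.
apply: (@le_trans _ _ 'N[mu]_p%:E[EFin \o
    ((@scalar_abs R s \o phi) \+ (@scalar_abs R s \o psi))%R]%E).
  apply: le_Lnorm => //.
  - exact/scalar_measurable_abs/scalar_measurableD.
  - exact: measurable_funD.
  - by move=> x; exact: scalar_abs_ge0.
  - by move=> x; exact: scalar_absD.
exact: eminkowski.
Qed.

Lemma ae_eq_eLp_norm phi psi : scalar_measurable phi -> scalar_measurable psi ->
  phi = psi %[ae mu] -> eLp_norm phi = eLp_norm psi.
Proof.
move=> mphi mpsi pp; rewrite /eLp_norm unlock /Lnorm; congr (_ `^ _)%E.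
apply: ae_eq_integral => //.
- exact/measurable_abs_powR/scalar_measurable_abs.
- exact/measurable_abs_powR/scalar_measurable_abs.
by apply: filterS pp => x /= /(_ I) -> _.
Qed.

Lemma eLp_normZ (a : K) phi : scalar_measurable phi ->
  eLp_norm (a *: phi) = ((scalar_abs a)%:E * eLp_norm phi)%E.
Proof.
move=> mphi; rewrite /eLp_norm unlock /Lnorm.
under eq_integral => x _.
  rewrite (_ : _ `^ _ = (scalar_abs a `^ p)%:E *
    (`|(EFin \o (@scalar_abs R s \o phi)) x| `^ p))%E; last first.
    rewrite /= (scalar_absM a (phi x)) normrM powRM// EFinM.
    by rewrite (ger0_norm (scalar_abs_ge0 a)).
  over.
rewrite ge0_integralZl//; last 2 first.
- by move=> *; exact: poweR_ge0.
- by rewrite lee_fin powR_ge0.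
rewrite poweRM ?integral_ge0 ?lee_fin ?powR_ge0//; last first.
  by move=> *; exact: poweR_ge0.
by rewrite poweR_EFin -powRrM mulfV ?gt_eqF// powRr1// scalar_abs_ge0.
exact/measurable_abs_powR/scalar_measurable_abs.
Qed.

Lemma eLp_norm_eq0 phi : scalar_measurable phi -> eLp_norm phi = 0%E ->
  phi = cst 0 %[ae mu].
Proof.
move=> mphi /Lnorm_eq0_eq0 h.
have /h : measurable_fun setT (EFin \o (@scalar_abs R s \o phi)).
  exact/measurable_EFinP/scalar_measurable_abs.
rewrite lte_fin => /(_ p0); apply: filterS => x /= /(_ I) [] e _.
exact: scalar_abs_eq0.
Qed.

Lemma Lp_fun_predP phi : reflect
  (scalar_measurable phi /\ (eLp_norm phi < +oo)%E) (phi \in Lp_fun_pred p1).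
Proof. exact: asboolP. Qed.

Lemma Lp_fun_submod_closed : submod_closed (Lp_fun_pred p1).
Proof.
split.
  apply/Lp_fun_predP; split; first exact: scalar_measurable0.
  by rewrite eLp_norm0 ltry.
move=> a phi psi /Lp_fun_predP[mphi fphi] /Lp_fun_predP[mpsi fpsi].
have maphi := scalar_measurableZ a mphi.
apply/Lp_fun_predP; split; first exact: scalar_measurableD.
apply: (le_lt_trans (eLp_normD maphi mpsi)).
rewrite eLp_normZ// lte_add_pinfty// lte_mul_pinfty//.
by rewrite lee_fin scalar_abs_ge0.
Qed.

HB.instance Definition _ :=
  GRing.isSubmodClosed.Build K (X -> K) (Lp_fun_pred p1) Lp_fun_submod_closed.

Record Lp_fun := LpFun { Lp_fun_val :> X -> K; _ : Lp_fun_val \in Lp_fun_pred p1 }.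
HB.instance Definition _ := [isSub for Lp_fun_val].
HB.instance Definition _ := [Choice of Lp_fun by <:].
HB.instance Definition _ := [SubChoice_isSubLmodule of Lp_fun by <:].

Lemma Lp_fun_measurable (phi : Lp_fun) : scalar_measurable phi.
Proof. by have /Lp_fun_predP[] := valP phi. Qed.

Lemma Lp_fun_lty (phi : Lp_fun) : (eLp_norm phi < +oo)%E.
Proof. by have /Lp_fun_predP[] := valP phi. Qed.

Definition Lp_null : {pred Lp_fun} :=
  fun phi => `[< (phi : X -> K) = cst 0 %[ae mu] >].

Lemma Lp_null_submod_closed : submod_closed Lp_null.
Proof.
split; first by apply/asboolP; exact: aeW.
move=> a phi psi /asboolP n1 /asboolP n2; apply/asboolP.
apply: filterS2 n1 n2 => x /= /(_ I) e1 /(_ I) e2 _.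
by rewrite [LHS](_ : _ = a *: phi x + psi x)// e1 e2 scaler0 addr0.
Qed.

HB.instance Definition _ :=
  GRing.isSubmodClosed.Build K Lp_fun Lp_null Lp_null_submod_closed.


Definition Lp := Quotient.quot Lp_null.

End LpFunctions.

Section LpSpace.
Context (R : realType) (s : scalars) d (X : measurableType d).
Variables (mu : {measure set X -> \bar R}) (p : R) (p1 : 1 <= p).
Local Notation K := (scalar_field R s).
Local Notation Lp_fun := (Lp_fun s mu p1).
Local Notation Lp := (Lp s mu p1).
Local Open Scope quotient_scope.

HB.instance Definition _ := GRing.Zmodule.on Lp.
HB.instance Definition _ := EqQuotient.on Lp.

Definition Lp_class (phi : Lp_fun) : Lp := \pi_Lp phi.

Lemma Lp_classP (phi psi : Lp_fun) :
  Lp_class phi = Lp_class psi <-> (phi : X -> K) = psi %[ae mu].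
Proof.
rewrite /Lp_class; split=> [/eqP|h].
  rewrite -Quotient.idealrBE => /asboolP; apply: filterS => x /= /(_ I) e _.
  by apply/eqP; rewrite -subr_eq0; apply/eqP.
apply/eqP; rewrite -Quotient.idealrBE; apply/asboolP.
by apply: filterS h => x /= /(_ I) e _; rewrite [LHS](_ : _ = phi x - psi x)// e subrr.
Qed.

Lemma Lp_reprK (u : Lp) : Lp_class (repr u) = u.
Proof. exact: reprK. Qed.

Lemma Lp_classD : {morph Lp_class : phi psi / phi + psi}.
Proof. by move=> phi psi; rewrite /Lp_class raddfD. Qed.

Definition Lp_scale (a : K) (u : Lp) : Lp := Lp_class (a *: repr u).

Lemma Lp_scaleE a phi : Lp_scale a (Lp_class phi) = Lp_class (a *: phi).
Proof.
apply/Lp_classP; have /Lp_classP := Lp_reprK (Lp_class phi).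
by apply: filterS => x /= /(_ I) e _; congr (_ *: _).
Qed.

Let Lp_scaleA a b u : Lp_scale a (Lp_scale b u) = Lp_scale (a * b) u.
Proof. by rewrite -[u]Lp_reprK !Lp_scaleE scalerA. Qed.

Let Lp_scale1 : left_id 1 Lp_scale.
Proof. by move=> u; rewrite -[u]Lp_reprK Lp_scaleE scale1r. Qed.

Let Lp_scaleDr : right_distributive Lp_scale +%R.
Proof.
move=> a u v; rewrite -[u]Lp_reprK -[v]Lp_reprK -Lp_classD !Lp_scaleE.
by rewrite scalerDr Lp_classD.
Qed.

Let Lp_scaleDl u : {morph Lp_scale^~ u : a b / a + b}.
Proof.
by move=> a b; rewrite -[u]Lp_reprK !Lp_scaleE scalerDl Lp_classD.
Qed.

HB.instance Definition _ := GRing.Zmodule_isLmodule.Build K Lp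
  Lp_scaleA Lp_scale1 Lp_scaleDr Lp_scaleDl.

Definition Lp_norm (u : Lp) : R := fine (eLp_norm mu p (repr u)).

Lemma Lp_normE (phi : Lp_fun) : (Lp_norm (Lp_class phi))%:E = eLp_norm mu p phi.
Proof.
rewrite /Lp_norm fineK; last first.
  by rewrite ge0_fin_numE ?eLp_norm_ge0// Lp_fun_lty.
apply: ae_eq_eLp_norm; [exact: Lp_fun_measurable|exact: Lp_fun_measurable|].
by apply/Lp_classP; exact: Lp_reprK.
Qed.

Let Lp_norm_scalar (u : Lp) : K := scalar_of_real s (Lp_norm u).

Let ler_Lp_normD u v :
  Lp_norm_scalar (u + v) <= Lp_norm_scalar u + Lp_norm_scalar v.
Proof.
rewrite /Lp_norm_scalar -scalar_of_realD scalar_of_real_le -lee_fin EFinD.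
rewrite -[u]Lp_reprK -[v]Lp_reprK -Lp_classD !Lp_normE.
by apply: eLp_normD => //; exact: Lp_fun_measurable.
Qed.

Let Lp_normZ a u : Lp_norm_scalar (a *: u) = `|a| * Lp_norm_scalar u.
Proof.
rewrite /Lp_norm_scalar scalar_absE -scalar_of_realM; congr scalar_of_real.
apply: EFin_inj; rewrite EFinM -[u]Lp_reprK.
rewrite [_ *: _](Lp_scaleE a (repr u)) !Lp_normE.
by apply: eLp_normZ => //; exact: Lp_fun_measurable.
Qed.

Let Lp_norm_eq0 u : Lp_norm_scalar u = 0 -> u = 0.
Proof.
rewrite /Lp_norm_scalar -(scalar_of_real0 R s) => /scalar_of_real_inj.
move=> u0; have n0 : eLp_norm mu p (repr u) = 0%E by rewrite -Lp_normE Lp_reprK u0.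
rewrite -[LHS]Lp_reprK (_ : 0 = Lp_class 0); last by rewrite /Lp_class raddf0.
apply/Lp_classP; have := eLp_norm_eq0 p1 (Lp_fun_measurable (repr u)) n0.
by apply: filterS => x /= /(_ I) ->.
Qed.

HB.instance Definition _ := Lmodule_isNormed.Build K Lp
  ler_Lp_normD Lp_normZ Lp_norm_eq0.

Lemma Lp_normrE (u : Lp) : `|u| = scalar_of_real s (Lp_norm u).
Proof. by []. Qed.

End LpSpace.

Section CompositionOperator.
Context (R : realType) d (X : measurableType d).
Variable mu : {measure set X -> \bar R}.

Definition nonsingular (g : X -> X) : Prop :=
  exists2 c : R, 0 < c &
    forall B, measurable B -> (mu (g @^-1` B) <= c%:E * mu B)%E.

Record nonsingular_bijection (f finv : X -> X) : Prop := NonsingularBijection {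
  fwdK : cancel f finv;
  bwdK : cancel finv f;
  measurable_fwd : measurable_fun [set: X] f;
  measurable_bwd : measurable_fun [set: X] finv;
  nonsingular_fwd : nonsingular f;
  nonsingular_bwd : nonsingular finv
}.

Variables (s : scalars) (p : R) (p1 : 1 <= p) (f finv : X -> X).
Hypothesis hf : nonsingular_bijection f finv.
Local Notation K := (scalar_field R s).
Local Notation Lp_fun := (Lp_fun s mu p1).
Local Notation Lp := (Lp s mu p1).

Let p0 : 0 < p. Proof. exact: lt_le_trans p1. Qed.

Lemma eLp_norm_comp_le : exists2 c : R, 0 <= c & forall phi : Lp_fun,
  (eLp_norm mu p (phi \o f) <= c%:E * eLp_norm mu p phi)%E.
Proof.
have [c c0 hc] := nonsingular_fwd hf.
exists (c `^ p^-1); first exact: powR_ge0.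
move=> phi; apply: (@Lnorm_comp_le _ _ _ mu p c f (@scalar_abs R s \o phi)) => //.
- exact: ltW.
- exact: measurable_fwd hf.
- exact/scalar_measurable_abs/Lp_fun_measurable.
Qed.

Lemma Lp_fun_comp_subproof (phi : Lp_fun) : phi \o f \in Lp_fun_pred mu p1.
Proof.
apply/Lp_fun_predP; split.
  by apply: scalar_measurable_comp; [exact: measurable_fwd hf|
                                     exact: Lp_fun_measurable].
have [c c0 hc] := eLp_norm_comp_le.
by rewrite (le_lt_trans (hc phi))// lte_mul_pinfty ?lee_fin// Lp_fun_lty.
Qed.

Definition Lp_fun_comp (phi : Lp_fun) : Lp_fun := LpFun (Lp_fun_comp_subproof phi).

(* Independent of the chosen representative: see comp_opE. *)
Definition comp_op (u : Lp) : Lp := Lp_class (Lp_fun_comp (repr u)).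

Lemma comp_opE (phi : Lp_fun) : comp_op (Lp_class phi) = Lp_class (Lp_fun_comp phi).
Proof.
apply/Lp_classP; have /Lp_classP [N [mN N0 hN]] := Lp_reprK (Lp_class phi).
have mfN : measurable (f @^-1` N).
  by rewrite -[_ @^-1` _]setTI; exact: (measurable_fwd hf).
exists (f @^-1` N); split => //.
  have [c c0 /(_ _ mN)] := nonsingular_fwd hf.
  by rewrite N0 mule0 => h; apply/eqP; rewrite eq_le h measure_ge0.
by move=> x /= h; apply: hN => /= h'; apply: h => _ /=; exact: h'.
Qed.

Lemma comp_op_linear : linear comp_op.
Proof.
move=> a u v; have sE (phi : Lp_fun) : a *: Lp_class phi = Lp_class (a *: phi).
  exact: Lp_scaleE.
rewrite -[u]Lp_reprK -[v]Lp_reprK sE -Lp_classD !comp_opE sE -Lp_classD.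
by congr Lp_class; exact: val_inj.
Qed.

HB.instance Definition _ := GRing.isLinear.Build K Lp Lp _ comp_op comp_op_linear.

Lemma comp_op_continuous : continuous comp_op.
Proof.
have [c c0 hc] := eLp_norm_comp_le.
have {}hc u : Lp_norm (comp_op u) <= c * Lp_norm u.
  by rewrite -lee_fin EFinM -[u]Lp_reprK comp_opE !Lp_normE; exact: hc.
apply: bounded_linear_continuous; apply/linear_boundedP.
near=> r => u; have cr : scalar_of_real s c <= r.
  near: r; apply: nbhs_pinfty_ge.
  by rewrite ger0_real// -(scalar_of_real0 R s) scalar_of_real_le.
apply: (le_trans _ (ler_wpM2r (normr_ge0 u) cr)).
by rewrite !Lp_normrE -scalar_of_realM scalar_of_real_le; exact: hc.
Unshelve. all: by end_near. Qed.

End CompositionOperator.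

Section Dissipative.
Context (R : realType) d (X : measurableType d).
Variables (mu : {measure set X -> \bar R}) (f finv : X -> X).

Definition iterz (k : int) : X -> X :=
  match k with
  | Posz n => iter n f
  | Negz n => iter n.+1 finv
  end.

Definition dissipative_witness (W : set X) : Prop :=
  [/\ measurable W, (0 < mu W)%E, (mu W < +oo)%E,
      \bigcup_(k : int) (iterz k @` W) = [set: X] &
      trivIset [set: int] (fun k => iterz k @` W)].

Definition bounded_distortion_on (W : set X) : Prop :=
  exists2 K : R, 0 < K & forall (k : int) (B' : set X), measurable B' ->
    let B := B' `&` W in
    ((K^-1)%:E * (mu (iterz k @` W) * mu B) <= mu (iterz k @` B) * mu W)%E /\
    (mu (iterz k @` B) * mu W <= K%:E * (mu (iterz k @` W) * mu B))%E.

Definition dissipative_bounded_distortion : Prop :=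
  exists2 W, dissipative_witness W & bounded_distortion_on W.

End Dissipative.

Definition separable (E : topologicalType) : Prop :=
  exists2 D : set E, countable D & dense D.

Section FrequentDynamics.
Variables (R : realType) (E : topologicalType) (T : E -> E).

Definition visit_count (x : E) (U : set E) (N : nat) : nat :=
  count (fun n => iter n T x \in U) (iota 1 N).

(* At N = 0 the quotient is 0 / 0 = 0, which does not affect the lower limit. *)
Definition lower_visit_density (x : E) (U : set E) : R :=
  limn_inf (fun N => (visit_count x U N)%:R / N%:R).

Definition frequently_recurrent_vector (x : E) : Prop :=
  forall U : set E, nbhs x U -> 0 < lower_visit_density x U.

Definition frequently_recurrent : Prop :=
  dense [set x | frequently_recurrent_vector x].

Definition frequently_hypercyclic : Prop :=
  exists x : E, forall U : set E, open U -> U !=set0 ->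
    0 < lower_visit_density x U.

End FrequentDynamics.

Arguments comp_op {R d X mu} s {p} p1 {f finv} hf.
Arguments Lp {R} s {d X} mu {p} p1.

(* Main.v *)
From HB Require Import structures.
Require Import Defs.
From mathcomp Require Import all_boot all_order all_algebra.
From mathcomp Require Import all_classical all_reals all_analysis.
From mathcomp Require Import complex measurable_realfun zify lra.

(* Both properties amount to mu X < +oo, i.e. to summability of the weights
   w k := mu (f^k W).

   Suppose T is frequently recurrent. Take a frequently recurrent phi close to
   1_W, and let E be the set, of positive lower density, of those n for which
   phi o f^n is close to 1 on most of W. By bounded distortion, for m, n in E the
   function phi o f^m is at least 1/2 in modulus on a fixed proportion of
   f^(n - m) W, while it is small in norm off W; so the sums of w (n - m) over n
   in E, n <> m, are bounded uniformly in m in E. Averaging over m in E, n <= N,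
   the weights at the differences that occur at least eta N times have bounded
   sum; finitely many translates of that set of differences cover any given
   window of integers, and w (k + a) <= c^|a| w k. (Bayart-Ruzsa argument.)

   Conversely, suppose mu X < +oo. Let rank x := |k| for x in f^k W, let t l be
   the measure of [rank >= l], and truncate a dense sequence, each term being
   repeated infinitely often, at height M l := t l ^ (- 1 / 2p), to get psi_0,
   psi_1, ... Place copies psi_j o f^-n, for n in pairwise separated sets of
   positive density A_j, on the disjoint blocks f^n [rank <= j]. For n in A_j,
   applying T^n to the resulting function gives psi_j on [rank <= j] and a
   function bounded by M (rank x) elsewhere, and the integral of M (rank x)^p
   over [rank >= j] is at most 2 sqrt (t j). *)

Set Implicit Arguments.
Unset Strict Implicit.
Unset Printing Implicit Defensive.

Import Order.TTheory GRing.Theory Num.Theory.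
Import numFieldNormedType.Exports.

Local Open Scope classical_set_scope.
Local Open Scope ring_scope.

(** * Positive lower density as an eventual linear lower bound *)

Section LowerDensity.
Variables (R : realType) (c : nat -> nat).
Hypothesis c_le : forall N, (c N <= N)%N.

(** The quotients lie in [[0, 1]], so the lower limit is the supremum of the infima over tails; it
    is positive exactly when one of these infima is. *)
Lemma limn_inf_count_gt0 :
  0 < limn_inf (fun N => (c N)%:R / N%:R : R) <->
  exists2 delta : R, 0 < delta &
    exists N0, forall N, (N0 <= N)%N -> delta * N%:R <= (c N)%:R.
Proof.
set u : (R^o)^nat := fun N => _.
have u0 N : 0 <= u N by rewrite /u divr_ge0.
have u1 N : u N <= 1.
  rewrite /u; case: N => [|N]; first by rewrite invr0 mulr0.
  by rewrite ler_pdivrMr ?ltr0n// mul1r ler_nat.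
have ulb : has_lbound (range u) by exists 0 => _ [n _ <-].
have uub : has_ubound (range u) by exists 1 => _ [n _ <-].
have -> : limn_inf u = sup (range (infs u)) by apply/cvg_lim => //; exact: cvg_infs_sup.
have hs N0 : has_inf (sdrop u N0).
  by split; [exists (u N0), N0 => /=|exists 0 => _ [n _ <-]].
split.
- move=> /sup_gt[].
    by exists (infs u 0%N), 0%N.
  (* Starting from [N0.+1] keeps the denominator [N] positive. *)
  move=> _ [N0 _ <-] h; exists (infs u N0) => //; exists N0.+1 => N N0N.
  have N_gt0 : (0 < N)%N by exact: leq_ltn_trans N0N.
  rewrite -ler_pdivlMr ?ltr0n//; apply: ge_inf; first exact: (hs N0).2.
  by exists N => //=; exact: ltnW.
- move=> [delta d0 [N0 h]]; apply: (@lt_le_trans _ _ delta) => //.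
  apply: (@le_trans _ _ (infs u N0.+1)).
    apply: lb_le_inf; first by exists (u N0.+1), N0.+1 => /=.
    move=> _ [N /= N0N <-]; rewrite /u ler_pdivlMr ?h ?(ltnW N0N)//.
    by rewrite ltr0n (leq_ltn_trans _ N0N).
  apply: ub_le_sup; last by exists N0.+1.
  exists 1 => _ [n _ <-]; apply: le_trans (u1 n).
  by apply: ge_inf; [exact: (hs n).2|exists n => /=].
Qed.

End LowerDensity.

(** * Differences within finite sets of integers *)

Section DifferenceSets.
Implicit Types (A ks Z J : seq int).

Definition difference_count A (k : int) : nat := count (fun z => z + k \in A) A.

(** Translation by [k] turns representations of [k] as a difference into representations of [- k];
    by symmetry one inequality suffices. *)
Lemma difference_countN A k : uniq A ->
  difference_count A (- k) = difference_count A k.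
Proof.
suff h A' k' : uniq A' -> (difference_count A' k' <= difference_count A' (- k'))%N.
  by move=> uA; apply/eqP; rewrite eqn_leq h// -{2}[k]opprK h.
move=> uA; rewrite /difference_count -!size_filter.
rewrite -(size_map (fun z => z + k')); apply: uniq_leq_size.
  by rewrite map_inj_uniq ?filter_uniq//; exact: addIr.
move=> _ /mapP[z + ->]; rewrite !mem_filter => /andP[-> zA].
by rewrite addrK zA.
Qed.

(* Counts the incidences [t - k \in A] over [t \in Z]: by [x <= 1 + x (x - 1)]
   translates of A that hardly meet pairwise take up much room. *)
Lemma translates_leq A ks Z : uniq A -> uniq ks -> uniq Z ->
  (forall a k, a \in A -> k \in ks -> a + k \in Z) ->
  (size ks * size A <=
    size Z + \sum_(k <- ks) \sum_(k' <- ks | k' != k) difference_count A (k - k')%R)%N.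
Proof.
move=> uA uks uZ AZ.
have -> : (size ks * size A = \sum_(t <- Z) \sum_(k <- ks) ((t - k)%R \in A))%N.
  rewrite exchange_big/= -sum1_size big_distrl/= !big_seq; apply: eq_bigr => k kks.
  rewrite mul1n.
  have -> : (\sum_(t <- Z) ((t - k)%R \in A) = count (fun t => (t - k)%R \in A) Z)%N.
    by rewrite -sum1_count [RHS]big_mkcond/=; apply: eq_bigr => t _; case: ifP.
  rewrite -size_filter -(size_map (fun a => a + k) A); apply: perm_size.
  apply: uniq_perm; rewrite ?filter_uniq//.
    by rewrite map_inj_uniq//; exact: addIr.
  move=> t; rewrite mem_filter; apply/mapP/andP => [[a aA ->]|[tA _]].
    by rewrite addrK aA AZ.
  by exists (t - k) => //; rewrite subrK.
have -> : (size Z = \sum_(t <- Z) 1)%N by rewrite sum1_size.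
have le1 t : (\sum_(k <- ks) ((t - k)%R \in A) <=
    1 + \sum_(k <- ks) \sum_(k' <- ks | k' != k)
        (((t - k)%R \in A) && ((t - k')%R \in A)))%N.
  have [/hasP[k kks kA]|/hasPn h] := boolP (has (fun k => (t - k)%R \in A) ks); last first.
    by rewrite big_seq big1// => k /h /negbTE ->.
  rewrite (bigD1_seq k)//= kA leq_add2l.
  rewrite [leqRHS](bigD1_seq k)//= (leq_trans _ (leq_addr _ _))//.
  by apply: leq_sum => k' _; rewrite kA.
apply: leq_trans (leq_sum _ (fun t _ => le1 t)) _.
rewrite big_split/= leq_add2l exchange_big/=; apply: leq_sum => k _.
rewrite exchange_big/=; apply: leq_sum => k' _.
have -> : (\sum_(t <- Z) (((t - k)%R \in A) && ((t - k')%R \in A)) =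
  count (fun t => ((t - k)%R \in A) && ((t - k')%R \in A)) Z)%N.
  by rewrite -sum1_count [RHS]big_mkcond/=; apply: eq_bigr => t _; case: ifP.
(* With [z = t - k] one has [t - k' = z + (k - k')]: each common point of two translates yields an
   occurrence of the difference [k - k']. *)
rewrite /difference_count -!size_filter -(size_map (fun t => t - k)).
apply: uniq_leq_size.
  by rewrite map_inj_uniq ?filter_uniq//; exact: addIr.
move=> _ /mapP[t + ->]; rewrite !mem_filter => /andP[/andP[-> h] _].
by rewrite addrA subrK h.
Qed.

End DifferenceSets.

(** * Weights along the differences of a set of positive lower density *)

Section WeightSummability.
Variables (R : realType) (E : pred nat) (w : int -> R) (c C delta : R) (N0 : nat).
Hypotheses (w_ge0 : forall k, 0 <= w k) (c_ge1 : 1 <= c) (C_ge0 : 0 <= C)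
  (w_shift : forall k a, w (k + a) <= c ^+ `|a|%N * w k)
  (delta_gt0 : 0 < delta)
  (E_dense : forall N, (N0 <= N)%N -> delta * N%:R <= (count E (iota 1 N))%:R)
  (w_sum : forall m (J : seq int), E m -> uniq J -> 0 \notin J ->
     (forall j, j \in J -> exists2 n, E n & j = n%:Z - m%:Z) ->
     \sum_(j <- J) w j <= C).

Let EN N : seq int := [seq Posz n | n <- iota 1 N & E n].

Let uniq_EN N : uniq (EN N).
Proof. by rewrite map_inj_uniq ?filter_uniq ?iota_uniq// => ? ? []. Qed.

Let size_EN N : size (EN N) = count E (iota 1 N).
Proof. by rewrite size_map size_filter. Qed.

Let size_EN_le N : (size (EN N) <= N)%N.
Proof. by rewrite size_EN (leq_trans (count_size _ _))// size_iota. Qed.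

(** Double counting of the pairs of [z] and [z + j] in [EN N]: for fixed [z] the weights of the
    admissible [j] add up to at most [C] by [w_sum], and there are at most [N] such [z]. *)
Let w_difference_count N (J : seq int) : uniq J -> 0 \notin J ->
  \sum_(j <- J) w j * (difference_count (EN N) j)%:R <= C * N%:R.
Proof.
move=> uJ J0.
have -> : \sum_(j <- J) w j * (difference_count (EN N) j)%:R =
    \sum_(z <- EN N) \sum_(j <- [seq j <- J | z + j \in EN N]) w j.
  under [RHS]eq_bigr do rewrite big_filter big_mkcond.
  rewrite exchange_big/=; apply: eq_bigr => j _.
  rewrite /difference_count -sum1_count natr_sum mulr_sumr big_mkcond/=.
  by apply: eq_bigr => z _; case: ifP; rewrite ?mulr1.
apply: (@le_trans _ _ (\sum_(z <- EN N) C)).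
  rewrite !big_seq; apply: ler_sum => z /mapP[m]; rewrite mem_filter => /andP[Em _] ->.
  apply: (@w_sum m) => //; rewrite ?filter_uniq//.
    by rewrite mem_filter negb_and J0 orbT.
  move=> j; rewrite mem_filter => /andP[/mapP[n]]; rewrite mem_filter => /andP[En _].
  by move=> e _; exists n => //; rewrite -e addrC addKr.

by rewrite big_const_seq count_predT iter_addr_0 -[C *+ _]mulr_natr ler_wpM2l// ler_nat.
Qed.

(** For large [N], [L] translates of [EN N] have total size at least [4 N], too much for a window of
    length about [N], while [eta] keeps the overlaps of all pairs of translates below [N]
    altogether. *)
Let L := (Num.bound (4 / delta)).+1.

Let L_large : 4 <= L%:R * delta.
Proof.
rewrite -ler_pdivrMr// ltW// (lt_le_trans (archi_boundP _))//.
  by rewrite divr_ge0// ltW.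
by rewrite ler_nat.
Qed.

Let L_gt0 : (0 : R) < L%:R. Proof. by rewrite ltr0n. Qed.

Let eta : R := (L%:R ^+ 2)^-1.

Let eta_gt0 : 0 < eta. Proof. by rewrite invr_gt0 exprn_gt0. Qed.

Let sparse N (ks : seq int) := forall k k', k \in ks -> k' \in ks -> k' != k ->
  (difference_count (EN N) (k - k'))%:R < eta * N%:R.

(** Sparsity is asked for arbitrarily large [N] only, so that its negation holds for all large [N]
    and can be combined over finitely many lists. *)
Let often_sparse ks := uniq ks /\ forall N1, exists2 N, (N1 <= N)%N & sparse N ks.

(** With [D] the largest modulus in [ls], [translates_leq] would give [4 N <= N + (2 D + 1) + N],
    which is false once [D < N]. *)
Let size_often_sparse ks : often_sparse ks -> (size ks < L)%N.
Proof.
move=> [uks hks]; rewrite ltnNge; apply/negP => Lks.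
pose ls := take L ks.
have sls : size ls = L by rewrite size_takel.
have uls : uniq ls by exact: take_uniq.
pose D := (\max_(k <- ls) `|k|%N)%N.
have leD k : k \in ls -> (`|k| <= D)%N.
  by move=> kls; rewrite /D (bigD1_seq k)//= leq_maxl.
have [N NN hN] := hks (maxn N0 D.+1).
have NN0 : (N0 <= N)%N by apply: leq_trans NN; rewrite leq_maxl.
have ND : (D.+1 <= N)%N by apply: leq_trans NN; rewrite leq_maxr.
(* The window from [- D] to [N + D] contains every translate of [EN N] by an element of [ls]. *)
pose Z := [seq Posz i - Posz D | i <- iota 0 (N + 2 * D + 1)].
have := @translates_leq (EN N) ls Z (uniq_EN N) uls.
have uZ : uniq Z by rewrite map_inj_uniq ?iota_uniq// => i j /addIr [].
have AZ a k : a \in EN N -> k \in ls -> a + k \in Z.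
  move=> /mapP[m]; rewrite mem_filter mem_iota => /andP[_ mN] -> /leD kD.
  by apply/mapP; exists (absz (Posz m + k + Posz D)); [rewrite mem_iota; lia|lia].
move=> /(_ uZ AZ).
have sZ : size Z = (N + 2 * D + 1)%N by rewrite size_map size_iota.
rewrite sls sZ => h.
have : (\sum_(k <- ls) \sum_(k' <- ls | k' != k)
    (difference_count (EN N) (k - k'))%:R : R) <= N%:R.
  apply: (@le_trans _ _ (\sum_(k <- ls) \sum_(k' <- ls) (eta * N%:R))).
    rewrite !big_seq; apply: ler_sum => k kls.
    rewrite big_mkcond/= !big_seq; apply: ler_sum => k' k'ls.
    case: ifP => kk; last by rewrite mulr_ge0// ltW.
    by apply/ltW/hN => //; apply: mem_take; [exact: kls|exact: k'ls].
  rewrite !big_const_seq !count_predT sls !iter_addr_0.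
  rewrite -mulrnA -[_ *+ (L * L)]mulr_natl natrM -expr2 mulrA mulfV ?mul1r//.
  by rewrite expf_neq0// gt_eqF.
have : ((L * size (EN N))%N%:R : R) <= (N + 2 * D + 1 + \sum_(k <- ls)
    \sum_(k' <- ls | k' != k) difference_count (EN N) (k - k')%R)%N%:R.
  by rewrite ler_nat.
rewrite natrD natr_sum natrM size_EN.
under [X in _ <= _ + X]eq_bigr do rewrite natr_sum.
have := E_dense NN0; move: (count _ _) => e he h1 h2.
have : L%:R * (delta * N%:R) <= (L%:R * e%:R : R) by rewrite ler_wpM2l// ltW.
have : 4 * N%:R <= L%:R * delta * (N%:R : R) by rewrite ler_wpM2r.
have : (D%:R + 1 : R) <= N%:R by rewrite natr1 ler_nat.
by move: h1 h2; rewrite !natrD mulrA; lra.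
Qed.

(** A maximal [often_sparse] list [ks] exists because lengths are bounded by [L]. By maximality
    every [j] outside it has a frequent difference [j - k] with some [k] in [ks], and [w_shift]
    charges [w j] to [w (j - k)]. *)
Lemma bounded_weight_sums :
  exists B, forall J : seq int, uniq J -> \sum_(j <- J) w j <= B.
Proof.
have [ks sks ks_max] : exists2 ks, often_sparse ks &
    forall k, k \notin ks -> ~ often_sparse (k :: ks).
  have P0 : exists n, `[<exists2 ks, often_sparse ks & size ks = n>].
    exists 0%N; apply/asboolP; exists [::] => //; split=> // N1.
    by exists N1.
  have Pub n : `[<exists2 ks, often_sparse ks & size ks = n>] -> (n <= L)%N.
    by move=> /asboolP[ks /size_often_sparse /ltnW ksL <-].
  case: (ex_maxnP P0 Pub) => n /asboolP[ks sks <-] nmax; exists ks => // k _ h.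
  by have := nmax (size ks).+1; rewrite ltnn => /(_ _)/notF; apply;
     apply/asboolP; exists (k :: ks).
pose D := (\max_(k <- ks) `|k|%N)%N.
have [uks hks] := sks.
have leD k : k \in ks -> (`|k| <= D)%N.
  by move=> kks; rewrite /D (bigD1_seq k)//= leq_maxl.
exists (\sum_(k <- ks) (w k + c ^+ D * (C / eta))) => J uJ.
(* As [J] is finite, one threshold serves all its elements; [ks] itself is sparse at some [N] beyond
   it. *)
have [N1 hN1] : exists N1, forall N j, (N1 <= N)%N -> j \in J -> j \notin ks ->
    ~ sparse N (j :: ks).
  elim: J {uJ} => [|j J [N1 IH]]; first by exists 0%N.
  have [jks|jks] := boolP (j \in ks).
    exists N1 => N i N1N; rewrite inE => /predU1P[->|]; first by rewrite jks.
    exact: IH.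
  have [N2 hN2] : exists N2, forall N, (N2 <= N)%N -> ~ sparse N (j :: ks).
    apply: contrapT => h; apply: (ks_max _ jks); split; first by rewrite /= jks.
    move=> N2; apply: contrapT => h2; apply: h; exists N2 => N N2N sN; apply: h2.
    by exists N.
  exists (maxn N1 N2) => N i; rewrite geq_max => /andP[N1N N2N].
  rewrite inE => /predU1P[-> _|]; first exact: hN2.
  exact: IH.
have [N NN1 sN] := hks (maxn 1 N1).
have N_gt0 : (0 : R) < N%:R.
  by rewrite ltr0n; apply: leq_trans NN1; rewrite leq_maxl.
have {}NN1 : (N1 <= N)%N by apply: leq_trans NN1; rewrite leq_maxr.
pose q (j : int) := w j * (difference_count (EN N) j)%:R.
have q_ge0 j : 0 <= q j by rewrite mulr_ge0.
have eN : 0 < eta * N%:R by rewrite mulr_gt0.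
have cD_ge0 : 0 <= c ^+ D by rewrite exprn_ge0// (le_trans _ c_ge1).
have wj j : j \in J -> w j <= \sum_(k <- ks)
    ((if k == j then w k else 0) +
     c ^+ D * ((if k == j then 0 else q (j - k)) / (eta * N%:R))).
  move=> jJ; have t_ge0 k : 0 <= (if k == j then w k else 0) +
      c ^+ D * ((if k == j then 0 else q (j - k)) / (eta * N%:R)).
    rewrite addr_ge0//; first by case: ifP.
    by rewrite mulr_ge0// divr_ge0 ?(ltW eN)//; case: ifP.
  have [jks|jks] := boolP (j \in ks).
    rewrite (bigD1_seq j)//= eqxx mul0r mulr0 addr0 lerDl.
    by apply: sumr_ge0.
  have [k kks hk] : exists2 k, k \in ks &
      eta * N%:R <= (difference_count (EN N) (j - k))%:R.
    (* Otherwise [j :: ks] would be sparse at [N]; the two orders of a pair agree by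
       [difference_countN]. *)
    apply: contrapT => h; apply: (hN1 N j NN1 jJ jks) => k k'.
    have {}h k1 : k1 \in ks -> (difference_count (EN N) (j - k1))%:R < eta * N%:R.
      by move=> k1ks; rewrite ltNge; apply/negP => h1; apply: h; exists k1.
    rewrite !inE => /predU1P[->|kks] /predU1P[->|k'ks]; first by rewrite eqxx.
    - by move=> _; exact: h.
    - by move=> _; rewrite -difference_countN// opprB; exact: h.
    - exact: sN.
  have kj : k == j = false by apply: contraNF jks => /eqP <-.
  rewrite (bigD1_seq k)//= kj add0r; apply: ler_wpDr; first exact: sumr_ge0.
  apply: (@le_trans _ _ (c ^+ D * w (j - k))).
    rewrite -{1}[j](subrK k); apply: le_trans (w_shift _ _) _.
    by rewrite ler_wpM2r// ler_weXn2l// leD.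
  rewrite ler_wpM2l// ler_pdivlMr// /q.
  by rewrite ler_wpM2l.
apply: (@le_trans _ _ (\sum_(j <- J) \sum_(k <- ks)
    ((if k == j then w k else 0) +
     c ^+ D * ((if k == j then 0 else q (j - k)) / (eta * N%:R))))).
  by rewrite big_seq [leRHS]big_seq; apply: ler_sum => j /wj.
rewrite exchange_big/=; apply: ler_sum => k _.
rewrite big_split/= lerD//.
  rewrite -big_mkcond/= -big_filter.
  have : (size [seq j <- J | k == j] <= 1)%N.
    by rewrite size_filter (eq_count (a2 := pred1 k))// ?count_uniq_mem ?leq_b1//
      => j /=; rewrite eq_sym.
  have : all (eq_op k) [seq j <- J | k == j] by exact: filter_all.
  case: [seq j <- J | k == j] => [|j [|//]] /=; first by rewrite big_nil.
  by rewrite andbT => /eqP <- _; rewrite big_seq1.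
rewrite -mulr_sumr ler_wpM2l// -mulr_suml ler_pdivrMr// mulrA divfK ?gt_eqF//.
(* The differences [j - k] are distinct and nonzero, so their weighted counts sum to at most
   [C * N]; the factor [N] has cancelled, and the final bound depends neither on [J] nor on [N]. *)
apply: le_trans (@w_difference_count N [seq j - k | j <- J & k != j] _ _).
- rewrite big_map big_filter [leRHS]big_mkcond/=.
  by apply: ler_sum => j _; case: eqP.
- by rewrite map_inj_uniq ?filter_uniq//; exact: addIr.
- apply/mapP => -[j]; rewrite mem_filter => /andP[kj _] /esym/eqP.
  by rewrite subr_eq0 eq_sym (negbTE kj).
Qed.

End WeightSummability.

(** * Frequent visits; frequent hypercyclicity implies frequent recurrence *)

Section FrequentVisits.
Variables (R : realType) (E : topologicalType) (T : E -> E).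

Lemma lower_visit_density_gt0 (x : E) (U : set E) :
  0 < lower_visit_density R T x U <->
  exists2 delta : R, 0 < delta & exists N0, forall N, (N0 <= N)%N ->
    delta * N%:R <= (visit_count T x U N)%:R.
Proof.
apply: limn_inf_count_gt0 => N.
by rewrite /visit_count (leq_trans (count_size _ _))// size_iota.
Qed.

Lemma frequent_visit (x : E) (U : set E) : 0 < lower_visit_density R T x U ->
  exists n, U (iter n T x).
Proof.
move=> /lower_visit_density_gt0[delta d0 [N0 /(_ _ (leqnSn N0))]].
have d1 : 0 < delta * N0.+1%:R by rewrite mulr_gt0.
move=> /(lt_le_trans d1); rewrite ltr0n -has_count => /hasP[n _].
by rewrite inE => Un; exists n.
Qed.

(** Starting the orbit [n] steps later loses at most [n] visits, which half of the density absorbs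
    once [N] is large. *)
Lemma lower_visit_density_iter (x : E) (U V : set E) n : U `<=` V ->
  0 < lower_visit_density R T x U ->
  0 < lower_visit_density R T (iter n T x) V.
Proof.
move=> UV /lower_visit_density_gt0[delta d0 [N0 h]].
apply/lower_visit_density_gt0; exists (delta / 2); first by rewrite divr_gt0.
have [N1 hN1] : exists N1 : nat, n%:R <= delta / 2 * N1%:R.
  exists (Num.bound (n%:R / (delta / 2))); rewrite mulrC -ler_pdivrMr ?divr_gt0//.
  by apply/ltW/archi_boundP; rewrite divr_ge0// ltW// divr_gt0.
exists (maxn N0 N1) => N; rewrite geq_max => /andP[/h hN N1N].
have : (visit_count T x U N <= n + visit_count T (iter n T x) V N)%N.
  rewrite /visit_count (@leq_trans (count (fun k => iter k T x \in U) (iota 1 (n + N))))//.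
    by rewrite addnC iotaD count_cat leq_addr.
  rewrite iotaD count_cat leq_add//.
    by rewrite (leq_trans (count_size _ _))// size_iota.
  rewrite addnC iotaDl count_map; apply: sub_count => k /=.
  by rewrite !inE addnC iterD => /UV.
rewrite -(ler_nat R) natrD.
have : delta / 2 * N1%:R <= delta / 2 * (N%:R : R).
  by rewrite ler_wpM2l ?ler_nat// ltW// divr_gt0.
lra.
Qed.

(** The orbit of a frequently hypercyclic vector is dense, and each of its points still visits every
    nonempty open set with positive lower density, in particular its own neighborhoods. *)
Lemma frequently_hypercyclic_recurrent :
  frequently_hypercyclic R T -> frequently_recurrent R T.
Proof.
move=> [x hx] O O0 oO; have [n On] := frequent_visit (hx O oO O0).
exists (iter n T x); split => // U /= nU.
apply: (@lower_visit_density_iter x U°); first exact: interior_subset.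
by apply: hx; [exact: open_interior|exists (iter n T x)].
Qed.

End FrequentVisits.

(** * Neighborhoods in [Lp] described by real radii *)

Section LpTopology.
Context (R : realType) (s : scalars) d (X : measurableType d).
Variables (mu : {measure set X -> \bar R}) (p : R) (p1 : 1 <= p).
Local Notation K := (scalar_field R s).
Local Notation Lp := (Lp s mu p1).
Local Notation Lp_fun := (Lp_fun s mu p1).

(** A positive complex number has imaginary part zero, so the radii of balls are real over either
    field. *)
Lemma scalar_of_real_gt0 (e : K) : 0 < e ->
  exists2 r : R, 0 < r & scalar_of_real s r = e.
Proof.
rewrite /scalar_of_real; case: s e => [e e0|[a b]]; first by exists (e : R).
by rewrite ltcE/= => /andP[/eqP -> a0]; exists a.
Qed.

Lemma Lp_normD (u v : Lp) : Lp_norm (u + v) <= Lp_norm u + Lp_norm v.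
Proof.
by rewrite -(@scalar_of_real_le R s) scalar_of_realD -!Lp_normrE ler_normD.
Qed.

Lemma Lp_distC (u v : Lp) : Lp_norm (u - v) = Lp_norm (v - u).
Proof. by apply: (@scalar_of_real_inj R s); rewrite -!Lp_normrE distrC. Qed.

Lemma Lp_distD (w u v : Lp) : Lp_norm (u - v) <= Lp_norm (u - w) + Lp_norm (w - v).
Proof. by rewrite (le_trans _ (Lp_normD _ _))// addrA subrK. Qed.

Lemma nbhs_Lp (u : Lp) (U : set Lp) :
  nbhs u U <-> exists2 e : R, 0 < e & forall v, Lp_norm (v - u) < e -> U v.
Proof.
split.
- move=> /nbhs_ballP[_ /scalar_of_real_gt0[e e0 <-]] h; exists e => // v uv.
  apply: h; rewrite -ball_normE/= Lp_normrE.
  by rewrite lt_neqAle scalar_of_real_le (inj_eq (@scalar_of_real_inj R s)) -lt_neqAle Lp_distC.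
- move=> [e e0 h]; apply/nbhs_ballP; exists (scalar_of_real s e).
    by rewrite /= lt_neqAle -(scalar_of_real0 R s) scalar_of_real_le
      (inj_eq (@scalar_of_real_inj R s)) -lt_neqAle.
  move=> v; rewrite -ball_normE/= Lp_normrE lt_neqAle scalar_of_real_le.
  by rewrite (inj_eq (@scalar_of_real_inj R s)) -lt_neqAle Lp_distC; exact: h.
Qed.

Lemma Lp_classB (phi psi : Lp_fun) :
  Lp_class phi - Lp_class psi = Lp_class (phi - psi).
Proof. by rewrite /Lp_class raddfB. Qed.

End LpTopology.

(** * Iterates of the composition operator *)

Section CompositionIterates.
Context (R : realType) d (X : measurableType d).
Variable mu : {measure set X -> \bar R}.
Variables (s : scalars) (p : R) (p1 : 1 <= p) (f finv : X -> X).
Hypothesis hf : nonsingular_bijection mu f finv.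
Local Notation Lp_fun := (Lp_fun s mu p1).

(** Provides a representative known at every point, not only almost everywhere, so that later
    arguments can be pointwise. *)
Lemma iter_comp_opE (phi : Lp_fun) n :
  exists2 psi : Lp_fun, iter n (comp_op s p1 hf) (Lp_class phi) = Lp_class psi
    & forall x, psi x = phi (iter n f x).
Proof.
elim: n => [|n [psi e h]]; first by exists phi.
exists (Lp_fun_comp hf psi); first by rewrite iterS e comp_opE.
by move=> x; rewrite iterSr -h.
Qed.

End CompositionIterates.

(** * Norm estimates through integrals of [p]-th powers *)

Section LpIntegral.
Context (R : realType) (s : scalars) d (X : measurableType d).
Variables (mu : {measure set X -> \bar R}) (p : R) (p1 : 1 <= p).
Local Notation K := (scalar_field R s).
Local Open Scope ereal_scope.

Let p_gt0 : (0 < p)%R. Proof. exact: lt_le_trans p1. Qed.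

Lemma measurable_abs_pow (phi : X -> K) : scalar_measurable phi ->
  measurable_fun setT (fun x => (scalar_abs (phi x) `^ p)%:E).
Proof.
move=> /scalar_measurable_abs mphi; apply/measurable_EFinP.
exact: (measurableT_comp (measurable_powR p) mphi).
Qed.

Lemma eLp_normE (phi : X -> K) :
  eLp_norm mu p phi = (\int[mu]_x (scalar_abs (phi x) `^ p)%:E) `^ p^-1.
Proof.
rewrite /eLp_norm unlock /Lnorm; congr (_ `^ _); apply: eq_integral => x _ /=.
by rewrite ger0_norm// scalar_abs_ge0.
Qed.

Lemma eLp_norm_le (phi : X -> K) (r : R) : (0 <= r)%R ->
  (eLp_norm mu p phi <= r%:E) =
  (\int[mu]_x (scalar_abs (phi x) `^ p)%:E <= (r `^ p)%:E).
Proof.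
move=> r0; rewrite eLp_normE.
have : 0 <= \int[mu]_x (scalar_abs (phi x) `^ p)%:E.
  by apply: integral_ge0 => x _; rewrite lee_fin powR_ge0.
move: (integral _ _ _) => I I0; apply/idP/idP => h.
- rewrite (_ : I = (I `^ p^-1) `^ p); last first.
    by rewrite -poweRrM mulVf ?gt_eqF// poweRe1.
  rewrite -poweR_EFin gt0_ler_poweR ?(ltW p_gt0)//.
  + by rewrite in_itv/= leey andbT; exact: poweR_ge0.
  + by rewrite in_itv/= leey andbT lee_fin.
- rewrite (_ : r%:E = ((r `^ p)%:E) `^ p^-1); last first.
    by rewrite poweR_EFin -powRrM mulfV ?gt_eqF// powRr1.
  rewrite gt0_ler_poweR ?invr_ge0 ?(ltW p_gt0)//.
  + by rewrite in_itv/= leey andbT.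
  + by rewrite in_itv/= leey andbT lee_fin powR_ge0.
Qed.

Lemma eLp_norm_lty (phi : X -> K) :
  \int[mu]_x (scalar_abs (phi x) `^ p)%:E < +oo -> eLp_norm mu p phi < +oo.
Proof. by move=> h; rewrite eLp_normE poweR_lty. Qed.

Lemma Lp_chebyshev (phi : X -> K) (a r : R) : scalar_measurable phi ->
  (0 < a)%R -> (0 <= r)%R -> eLp_norm mu p phi <= r%:E ->
  mu [set x | (a <= scalar_abs (phi x))%R] <= ((r / a) `^ p)%:E.
Proof.
move=> mphi a0 r0; rewrite eLp_norm_le// => h.
have mA : measurable [set x | (a <= scalar_abs (phi x))%R].
  have := scalar_measurable_abs mphi measurableT (measurable_itv `[a, +oo[).
  by rewrite setTI; congr measurable; apply/seteqP; split => x /=;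
    rewrite in_itv/= andbT.
have ap : (0 < a `^ p)%R by rewrite powR_gt0.
rewrite powRM ?invr_ge0 ?(ltW a0)//.
have -> : (a^-1 `^ p = (a `^ p)^-1)%R.
  by rewrite -powR_inv1 ?(ltW a0)// -!powRrM mulN1r powRN.
rewrite -(@lee_pmul2l _ (a `^ p)%:E)// ?lte_fin//.
rewrite -EFinM mulrC divfK ?gt_eqF// (le_trans _ h)//.
rewrite -integral_cst//.
have mfp := measurable_abs_pow mphi.
have fp_ge0 x : 0 <= (scalar_abs (phi x) `^ p)%:E by rewrite lee_fin powR_ge0.
apply: (@le_trans _ _ (\int[mu]_(x in [set x | (a <= scalar_abs (phi x))%R])
    (scalar_abs (phi x) `^ p)%:E)).
  apply: ge0_le_integral => //.
    by move=> x _; rewrite lee_fin ltW.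
    exact: measurable_funTS.
  move=> x /= ax; rewrite lee_fin.
  by rewrite ge0_ler_powR ?nnegrE ?(ltW p_gt0) ?(ltW a0) ?scalar_abs_ge0.
by apply: ge0_subset_integral.
Qed.

End LpIntegral.

(** * Finite disjoint families of sets *)

Section DisjointSum.
Context (R : realType) d (X : measurableType d).
Variable mu : {measure set X -> \bar R}.

Lemma sum_measure_le (I : eqType) (J : seq I) (A : I -> set X) (B : set X) :
  uniq J -> measurable B -> (forall j, j \in J -> measurable (A j)) ->
  (forall j, j \in J -> A j `<=` B) ->
  (forall i j, i \in J -> j \in J -> i != j -> A i `&` A j = set0) ->
  (\sum_(j <- J) mu (A j) <= mu B)%E.
Proof.
elim: J B => [|j J IH] B; first by rewrite big_nil measure_ge0.
move=> /= /andP[jJ uJ] mB mA AB AA.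
have mAj := mA _ (mem_head _ _).
rewrite big_cons (measureDI mu mB mAj) addeC leeD//.
  apply: IH => //; first exact: measurableD.
  - by move=> i iJ; apply: mA; rewrite inE iJ orbT.
  - move=> i iJ x Aix; split; first by apply: (AB i) => //; rewrite inE iJ orbT.
    move=> Ajx; have ij : i != j by apply: contraNneq jJ => <-.
    suff : (A i `&` A j) x by rewrite AA// ?inE ?eqxx ?iJ ?orbT.
    by [].
  - by move=> i i' iJ i'J; apply: AA; rewrite inE ?iJ ?i'J orbT.
by rewrite setIC (setIidl (AB _ (mem_head _ _))).
Qed.

End DisjointSum.

(** * Integer iterates of [f] *)

Section IntegerIterates.
Context (R : realType) d (X : measurableType d).
Variable mu : {measure set X -> \bar R}.
Variables (f finv : X -> X).
Hypothesis hf : nonsingular_bijection mu f finv.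
Local Notation fz := (iterz f finv).

Let fwdK := fwdK hf.
Let bwdK := bwdK hf.

Lemma iterzS k x : fz (k + 1) x = f (fz k x).
Proof.
case: k => n; first by rewrite [n%:Z + 1](_ : _ = n.+1%:Z)//; lia.
case: n => [|n]; first by rewrite /= bwdK.
by rewrite [_ + 1](_ : _ = Negz n) /= ?bwdK//; lia.
Qed.

Lemma iterzD k l x : fz (k + l) x = fz k (fz l x).
Proof.
elim: k => [|n IH|n IH]; first by rewrite add0r.
- rewrite [n.+1%:Z](_ : _ = n%:Z + 1); last lia.
  by rewrite addrAC !iterzS IH.
- apply: (can_inj fwdK); rewrite -!iterzS [- n.+1%:Z](_ : _ = - n%:Z - 1); last lia.
  by rewrite addrAC !subrK.
Qed.

Lemma iterzK k x : fz (- k) (fz k x) = x.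
Proof. by rewrite -iterzD addNr. Qed.

Lemma iterzNK k x : fz k (fz (- k) x) = x.
Proof. by rewrite -iterzD subrr. Qed.

(** Converts images, used for the translates of [W], into preimages, used for measurability and
    nonsingularity. *)
Lemma iterz_image k B : fz k @` B = fz (- k) @^-1` B.
Proof.
apply/seteqP; split => x /= => [[y By <-]|Bx]; first by rewrite iterzK.
by exists (fz (- k) x) => //; rewrite iterzNK.
Qed.

Lemma measurable_iterz k : measurable_fun setT (fz k).
Proof.
have it g n : measurable_fun setT g -> measurable_fun [set: X] (iter n g).
  move=> mg; elim: n => [|n IH]; first exact: measurable_id.
  exact: (measurableT_comp mg IH).
by case: k => n; [exact/it/(measurable_fwd hf)|exact/(it _ n.+1)/(measurable_bwd hf)].
Qed.

Lemma measurable_iterz_image k B : measurable B -> measurable (fz k @` B).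
Proof.
by move=> mB; rewrite iterz_image -[_ @^-1` _]setTI; exact: measurable_iterz.
Qed.

(** The constant [1 + c1 + c2] is at least 1 and dominates the constants of both [f] and its
    inverse; it is applied [|k|] times. *)
Lemma iterz_nonsingular : exists2 c : R, 1 <= c &
  forall k B, measurable B -> (mu (fz k @` B) <= (c ^+ `|k|%N)%:E * mu B)%E.
Proof.
have [c1 c1_gt0 h1] := nonsingular_fwd hf.
have [c2 c2_gt0 h2] := nonsingular_bwd hf.
pose c := 1 + c1 + c2; exists c; first by rewrite /c; lra.
have step g n B : measurable_fun setT g -> measurable B ->
    (forall B, measurable B -> (mu (g @^-1` B) <= c%:E * mu B)%E) ->
    (mu (iter n g @^-1` B) <= (c ^+ n)%:E * mu B)%E.
  move=> mg mB hg; elim: n B mB => [|n IH] B mB; first by rewrite expr0 mul1e.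
  have mgB : measurable (g @^-1` B) by rewrite -[_ @^-1` _]setTI; exact: mg.
  have -> : iter n.+1 g @^-1` B = iter n g @^-1` (g @^-1` B) by [].
  apply: (le_trans (IH _ mgB)); rewrite exprSr EFinM -muleA.
  by rewrite lee_wpmul2l ?hg// lee_fin exprn_ge0// /c; lra.
have cle c' B : 0 < c' -> c' <= c -> (c'%:E * mu B <= c%:E * mu B)%E.
  by move=> _ cc; rewrite lee_wpmul2r ?measure_ge0.
move=> k B mB; rewrite iterz_image; case: k => [[|n]|n].
- by rewrite expr0 mul1e.
- rewrite (_ : - n.+1%:Z = Negz n)//; apply: (step finv n.+1) => //.
    exact: measurable_bwd hf.
  by move=> B' mB'; apply: (le_trans (h2 _ mB')); apply: cle => //; rewrite /c; lra.
- rewrite NegzE opprK abszN; apply: (step f n.+1) => //.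
    exact: measurable_fwd hf.
  by move=> B' mB'; apply: (le_trans (h1 _ mB')); apply: cle => //; rewrite /c; lra.
Qed.

End IntegerIterates.

(** * Measures of the translates of the wandering set *)

Section WanderingWeights.
Context (R : realType) d (X : measurableType d).
Variable mu : {measure set X -> \bar R}.
Variables (f finv : X -> X) (W : set X).
Hypotheses (hf : nonsingular_bijection mu f finv)
  (hW : dissipative_witness mu f finv W).
Local Notation fz := (iterz f finv).

Definition wandering_weight (k : int) : R := fine (mu (fz k @` W)).
Local Notation w := wandering_weight.

Let mW : measurable W. Proof. by case: hW. Qed.

Lemma wandering_weightE k : (w k)%:E = mu (fz k @` W).
Proof.
have [c c1 h] := iterz_nonsingular hf; rewrite /w fineK//.
rewrite ge0_fin_numE ?measure_ge0//; apply: (le_lt_trans (h k W mW)).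
by rewrite lte_mul_pinfty ?lee_fin ?exprn_ge0 ?(le_trans ler01)//; case: hW.
Qed.

Lemma wandering_weight_ge0 k : 0 <= w k.
Proof. by rewrite fine_ge0// measure_ge0. Qed.

Lemma wandering_weight_shift : exists2 c : R, 1 <= c &
  forall k a, w (k + a) <= c ^+ `|a|%N * w k.
Proof.
have [c c1 h] := iterz_nonsingular hf; exists c => // k a.
rewrite -lee_fin EFinM !wandering_weightE.
have -> : fz (k + a) @` W = fz a @` (fz k @` W).
  by rewrite image_comp; congr (_ @` _); apply/funext => x /=; rewrite -(iterzD hf) addrC.
exact/h/(measurable_iterz_image hf).
Qed.

Lemma wandering_weight0 : (w 0)%:E = mu W.
Proof. by rewrite wandering_weightE /= image_id. Qed.

(** Shifting back by [- k] gives [w 0 <= c ^+ |k| * w k], and [w 0 = mu W] is positive. *)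
Lemma wandering_weight_gt0 k : 0 < w k.
Proof.
have [c c1 h] := wandering_weight_shift.
have w0 : 0 < w 0 by rewrite -lte_fin wandering_weight0; case: hW.
have := h k (- k); rewrite subrr => /(lt_le_trans w0).
by rewrite pmulr_rgt0// exprn_gt0//; lra.
Qed.

Lemma wandering_disjoint j k : j != k -> (fz j @` W) `&` (fz k @` W) = set0.
Proof.
case: hW => _ _ _ _ /trivIsetP; apply => //.
Qed.

End WanderingWeights.

(** * Indicator functions in [Lp] *)

Section Indicator.
Context (R : realType) (s : scalars) d (X : measurableType d).
Variables (mu : {measure set X -> \bar R}) (p : R) (p1 : 1 <= p).
Local Notation K := (scalar_field R s).
Local Notation Lp_fun := (Lp_fun s mu p1).

Lemma scalar_abs1 : scalar_abs (1 : K) = 1.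
Proof.
apply: (@scalar_of_real_inj R s); rewrite -scalar_absE normr1.
by rewrite /scalar_of_real; case: s.
Qed.

Lemma scalar_absN (z : K) : scalar_abs (- z) = scalar_abs z.
Proof.
apply: (@scalar_of_real_inj R s).
by rewrite -!scalar_absE normrN.
Qed.

Lemma scalar_measurable_ite (A : set X) (phi psi : X -> K) : measurable A ->
  scalar_measurable phi -> scalar_measurable psi ->
  scalar_measurable (fun x => if x \in A then phi x else psi x).
Proof.
move=> mA [mr mi] [nr ni].
have mbA : measurable_fun setT (fun x => x \in A).
  by apply: (measurable_fun_bool true); rewrite setTI (_ : _ @^-1` _ = A)//;
    apply/seteqP; split => x /=; [exact: set_mem|exact: mem_set].
split.
- rewrite (_ : _ \o _ = fun x => if x \in A then (@scalar_re R s \o phi) x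
    else (@scalar_re R s \o psi) x).
    by apply: measurable_fun_ifT.
  by apply/funext => x /=; case: ifP.
- rewrite (_ : _ \o _ = fun x => if x \in A then (@scalar_im R s \o phi) x
    else (@scalar_im R s \o psi) x).
    by apply: measurable_fun_ifT.
  by apply/funext => x /=; case: ifP.
Qed.

Lemma scalar_measurable_cst (a : K) : scalar_measurable (cst a : X -> K).
Proof.
split.
- by rewrite (_ : _ \o _ = cst (scalar_re a)).
- by rewrite (_ : _ \o _ = cst (scalar_im a)).
Qed.

Lemma Lp_indicator (W : set X) : measurable W -> (mu W < +oo)%E ->
  exists chi : Lp_fun, forall x, chi x = if x \in W then 1 else 0.
Proof.
move=> mW W_lty; pose phi (x : X) : K := if x \in W then 1 else 0.
have p0 : 0 < p by exact: lt_le_trans p1.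
suff h : phi \in Lp_fun_pred mu p1 by exists (LpFun h).
apply/Lp_fun_predP; split.
  exact: (scalar_measurable_ite mW (scalar_measurable_cst 1) (scalar_measurable_cst 0)).
apply: eLp_norm_lty => //.
rewrite (_ : (\int[mu]_x _ = mu W)%E)//.
rewrite -[in RHS](setIT W) -integral_indic//; apply: eq_integral => x _.
rewrite /phi indicE; case: ifP => _ /=; first by rewrite scalar_abs1 powR1.
by rewrite scalar_abs0 powR0// gt_eqF.
Qed.

End Indicator.

(** * Frequent recurrence bounds the sums of weights *)

Section RecurrenceFiniteMeasure.
Context (R : realType) (s : scalars) d (X : measurableType d).
Variables (mu : {measure set X -> \bar R}) (p : R) (p1 : 1 <= p).
Variables (f finv : X -> X) (W : set X).
Hypotheses (hf : nonsingular_bijection mu f finv)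
  (hW : dissipative_witness mu f finv W)
  (hD : bounded_distortion_on mu f finv W).
Local Notation K := (scalar_field R s).
Local Notation Lp_fun := (Lp_fun s mu p1).
Local Notation Lp := (Lp s mu p1).
Local Notation T := (comp_op s p1 hf).
Local Notation fz := (iterz f finv).
Local Notation w := (wandering_weight mu f finv W).

Let p_gt0 : 0 < p. Proof. exact: lt_le_trans p1. Qed.
Let mW : measurable W. Proof. by case: hW. Qed.
Let w0_gt0 : 0 < w 0. Proof. exact: (wandering_weight_gt0 hf hW). Qed.

(** With [c] the distortion constant, the lower distortion estimate shows that [f^k G] fills at
    least the fraction [1 / (2 c)] of [f^k W] when [G] fills half of [W]. *)
Lemma wandering_weight_image_half : exists2 c : R, 0 < c & forall k G,
  measurable G -> G `<=` W -> ((w 0 / 2)%:E <= mu G)%E ->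
  ((w k)%:E <= c%:E * mu (fz k @` G))%E.
Proof.
have [c c0 hc] := hD; exists (2 * c); first by rewrite mulr_gt0.
move=> k G mG GW hG; have [+ _] := hc k G mG.
rewrite (setIidl GW) -(wandering_weightE hf hW) -(wandering_weight0 hf hW).
have Gfin : mu G \is a fin_num.
  rewrite ge0_fin_numE ?measure_ge0//; case: hW => _ _ W_lty _ _.
  by apply: le_lt_trans W_lty; rewrite le_measure ?inE.
have kGfin : mu (fz k @` G) \is a fin_num.
  rewrite ge0_fin_numE ?measure_ge0//.
  apply: (@le_lt_trans _ _ (w k)%:E); last exact: ltry.
  rewrite (wandering_weightE hf hW) le_measure ?inE//.
  - exact: (measurable_iterz_image hf).
  - exact: (measurable_iterz_image hf).
  - exact: image_subset.
move: hG; rewrite -(fineK Gfin) -(fineK kGfin) -!EFinM !lee_fin.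
set g := fine _; set h := fine _ => hg h1.
have wk := wandering_weight_ge0 mu f finv W k.
have : c^-1 * (w k * (w 0 / 2)) <= h * w 0.
  by apply: le_trans h1; rewrite !ler_wpM2l// invr_ge0 ltW.
rewrite mulrC -[X in X / c <= _]mulrC ler_pdivrMr// => h2.
rewrite -(ler_pM2r w0_gt0); move: h2; lra.
Qed.

Lemma frequently_recurrent_weights : frequently_recurrent R T ->
  exists B, forall J : seq int, uniq J -> \sum_(j <- J) w j <= B.
Proof.
move=> FR; have [chi hchi] : exists chi : Lp_fun, forall x, chi x = if x \in W then 1 else 0.
  by apply: Lp_indicator => //; case: hW.
(* Chosen so that the Chebyshev bound at height one half, for a function of norm at most [2 e], is
   [(4 e) ^ p = w 0 / 2]. *)
pose e := 4^-1 * (w 0 / 2) `^ p^-1.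
have e0 : 0 < e by rewrite mulr_gt0// powR_gt0// divr_gt0.
have [u [uchi Fu]] : exists u : Lp, Lp_norm (u - Lp_class chi) < e /\
    frequently_recurrent_vector R T u.
  pose B := [set v : Lp | Lp_norm (v - Lp_class chi) < e].
  have nB : nbhs (Lp_class chi) B by apply/nbhs_Lp; exists e.
  have [|v [/interior_subset Bv Fv]] := FR B° _ (@open_interior _ B).
    by exists (Lp_class chi).
  by exists v.
pose U := [set v : Lp | Lp_norm (v - u) < e].
have /Fu/lower_visit_density_gt0[delta d0 [N0 hN0]] : nbhs u U.
  by apply/nbhs_Lp; exists e.
pose phi : Lp_fun := repr u.
pose bad n := [set x | 2^-1 <= scalar_abs (phi (iter n f x) - chi x)].
have mbad n : measurable (bad n).
  have [psi _ hpsi] := iter_comp_opE hf phi n.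
  have mpsi : measurable_fun setT (fun x => scalar_abs (psi x - chi x)).
    exact: scalar_measurable_abs (Lp_fun_measurable (psi - chi)).
  have := mpsi measurableT _ (measurable_itv `[2^-1, +oo[).
  rewrite setTI; congr measurable; apply/seteqP; split => x /=;
    by rewrite in_itv/= andbT hpsi.
have badE n : iter n T u \in U -> (mu (bad n) <= (w 0 / 2)%:E)%E.
  rewrite inE /U/= => Un.
  have [psi psiE hpsi] := iter_comp_opE hf phi n.
  rewrite Lp_reprK in psiE.
  have : Lp_norm (Lp_class (psi - chi)) <= 2 * e.
    rewrite -Lp_classB -psiE (le_trans (Lp_distD u _ _))//.
    by move: Un uchi; lra.
  rewrite -lee_fin Lp_normE => /(Lp_chebyshev p1) h.
  have := h 2^-1 (Lp_fun_measurable _).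
  rewrite invr_gt0 ltr0n mulr_ge0 ?(ltW e0)// => /(_ isT isT).
  rewrite (_ : _ `^ p = w 0 / 2); last first.
    rewrite /e invrK (_ : _ * 2 = (w 0 / 2) `^ p^-1); last by lra.
    by rewrite -powRrM mulVf ?gt_eqF// powRr1// divr_ge0// ltW.
  rewrite (_ : [set x | _] = bad n)//.
  by apply/funext => x /=; rewrite [X in scalar_abs X](_ : _ = psi x - chi x)// hpsi.
have [c c0 hc] := wandering_weight_image_half.
pose G n := W `\` bad n.
have mG n : measurable (G n) by exact: measurableD.
have hG n : iter n T u \in U -> ((w 0 / 2)%:E <= mu (G n))%E.
  move=> Un; have e1 : ((w 0)%:E = mu (G n) + mu (W `&` bad n))%E.
    by rewrite (wandering_weight0 hf hW); exact: measureDI.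
  have : (mu (W `&` bad n) <= (w 0 / 2)%:E)%E.
    apply: le_trans (badE n Un); rewrite le_measure ?inE//.
    exact: measurableI.
  move: e1; case: (mu (G n)) => [a| |]; case: (mu (_ `&` _)) => [b| |]//.
    rewrite -EFinD => -[] ->; rewrite !lee_fin ler_pdivlMr// ler_pdivrMr//.
    by rewrite !mulr_natr !mulr2n lerD2r lerD2l.
have [c' c'1 hc'] := wandering_weight_shift hf hW.
apply: (bounded_weight_sums (E := fun n => iter n T u \in U) (c := c')
  (C := c * (w 0 / 2)) (delta := delta) (N0 := N0)) => //.
- by move=> k; exact: wandering_weight_ge0.
- by rewrite mulr_ge0 ?(ltW c0)// divr_ge0// ltW.
move=> m J Em uJ J0 hJ.
(* For [j = n - m] with [n] a return time, [m + j] recovers [n], so [A j] is the image under [f^j]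
   of the good part [G n] of [W]. *)
pose A (j : int) := fz j @` G (absz (m%:Z + j)).
have AW j : A j `<=` fz j @` W by apply: image_subset => x [].
have sumA : (\sum_(j <- J) mu (A j) <= mu (bad m))%E.
  apply: sum_measure_le => // [j _|j jJ y|i j iJ jJ ij].
  - exact: (measurable_iterz_image hf).
  (* For [x] in [G n] and [y = f^j x], the value [phi (f^m y) = phi (f^n x)] is within one half of
     1, whereas [chi y = 0] because [j] is nonzero; hence [y] lies in [bad m]. *)
  - have [n En jE] := hJ j jJ; rewrite /A.
    rewrite (_ : absz _ = n); last by rewrite jE addrC subrK.
    move=> [x [Wx] /negP + <-]; rewrite /bad/= -ltNge hchi mem_set// => hx.
    have yW : ~ W (fz j x).
      move=> Wy; have : ((fz j @` W) `&` (fz 0 @` W)) (fz j x).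
        by split; [exists x|exists (fz j x)].
      by rewrite (wandering_disjoint hW)//; apply: contraNneq J0 => <-.
    rewrite hchi memNset// subr0.
    have -> : iter m f (fz j x) = iter n f x.
      rewrite (_ : iter m f _ = fz m%:Z (fz j x))// -(iterzD hf).
      by rewrite jE addrC subrK.
    have := scalar_absD (1 - phi (iter n f x)) (phi (iter n f x)).
    rewrite subrK scalar_abs1 -scalar_absN opprB => h1.
    have := splitr (1 : R); rewrite !mul1r => half.
    by rewrite -(lerD2l 2^-1) -half (le_trans h1)// lerD2r ltW.
  - apply/seteqP; split=> // x [/AW Ai /AW Aj].
    by rewrite -(wandering_disjoint hW ij); split.
rewrite -lee_fin; apply: (@le_trans _ _ (\sum_(j <- J) (c%:E * mu (A j)))%E).
  rewrite -sumEFin big_seq [leRHS]big_seq; apply: lee_sum => j jJ.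
  have [n En jE] := hJ j jJ.
  have nE : absz (m%:Z + j) = n by rewrite jE addrC subrK.
  rewrite /A nE; apply: hc => //; last exact: hG.
  by move=> x [].
rewrite -ge0_sume_distrr; last by move=> *; exact: measure_ge0.
rewrite EFinM lee_pmul2l //.
exact: le_trans sumA (badE m Em).
Qed.

End RecurrenceFiniteMeasure.

(** * From bounded sums of weights to finite measure *)

Section FiniteMeasure.
Context (R : realType) d (X : measurableType d).
Variable mu : {measure set X -> \bar R}.
Variables (f finv : X -> X) (W : set X).
Hypotheses (hf : nonsingular_bijection mu f finv)
  (hW : dissipative_witness mu f finv W).
Local Notation fz := (iterz f finv).
Local Notation w := (wandering_weight mu f finv W).

(** The unions [S n] of the [f^k W] with [|k| <= n] increase to [X] and have measure at most [B];
    continuity from below concludes. *)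
Lemma finite_measure_weights (B : R) :
  (forall J : seq int, uniq J -> \sum_(j <- J) w j <= B) -> (mu setT < +oo)%E.
Proof.
move=> hB; have [mW _ _ WT _] := hW.
pose J n : seq int := [seq Posz i - Posz n | i <- iota 0 (2 * n + 1)].
have uJ n : uniq (J n).
  by rewrite map_inj_uniq ?iota_uniq// => i j /addIr [].
have memJ n k : (k \in J n) = (absz k <= n)%N.
  apply/mapP/idP => [[i + ->]|kn]; first by rewrite mem_iota; lia.
  by exists (absz (k + Posz n)); [rewrite mem_iota|]; lia.
pose S n := \big[setU/set0]_(k <- J n) (fz k @` W).
have mfW k : measurable (fz k @` W) by exact: (measurable_iterz_image hf).
have mS n : measurable (S n) by exact: bigsetU_measurable.
have S_le n : (mu (S n) <= B%:E)%E.
  apply: (@le_trans _ _ (\sum_(k <- J n) mu (fz k @` W))%E).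
    rewrite /S; elim: (J n) => [|k s IH]; first by rewrite !big_nil measure0.
    rewrite !big_cons (le_trans (measureU2 _ _ _))//; first exact: bigsetU_measurable.
    by rewrite leeD2l.
  under eq_bigr do rewrite -(wandering_weightE hf hW).
  by rewrite sumEFin lee_fin hB.
have ndS : nondecreasing_seq S.
  move=> m n mn; apply/subsetPset => x; rewrite /S -!bigcup_seq => - [k/= km Wk].
  by exists k => //=; move: km; rewrite !memJ => /leq_trans; exact.
have ST : \bigcup_n S n = setT.
  apply/seteqP; split=> // x _; have : [set: X] x by [].
  rewrite -WT => - [k _ Wk]; exists (absz k) => //.
  by rewrite /S -bigcup_seq; exists k => //=; rewrite memJ.
have := @nondecreasing_cvg_mu _ _ _ mu S mS (bigcupT_measurable _ mS) ndS.
rewrite ST => cS; apply: (@le_lt_trans _ _ B%:E); last exact: ltry.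
rewrite -(cvg_lim _ cS)//; apply: lime_le; first by apply/cvg_ex; eexists; exact: cS.
by apply: nearW => n; exact: S_le.
Qed.

End FiniteMeasure.

(** * Separated times of positive density *)

Section SeparatedPositions.
Local Open Scope nat_scope.

(** The level of [m] is both the index of the function copied at time [position m] and the radius of
    the block of integers reserved for that copy. *)
Definition level (m : nat) : nat := logn 2 m.

(** Closed form of the sum of [2 level i + 1] over [1 <= i <= m], as the valuation of a factorial is
    the sum of the valuations of its factors. *)
Definition gap_sum (m : nat) : nat := 2 * logn 2 m`! + m.

(* The gap between consecutive positions is [2 level m + 1] plus
   [2 level (m + 1) + 1]; the average gap is finite since [level m = j] has
   density [2 ^- (j + 1)]. *)
Definition position (m : nat) : nat := gap_sum m + gap_sum m.-1.

Lemma gap_sumS m : gap_sum m.+1 = gap_sum m + (2 * level m.+1 + 1).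
Proof.
by rewrite /gap_sum factS lognM ?fact_gt0// /level; lia.
Qed.

Lemma gap_sum_mono : {homo gap_sum : m n / m <= n}.
Proof.
by apply: homo_leq => // [m n p|m]; [exact: leq_trans|rewrite gap_sumS leq_addr].
Qed.

(** Disjoint blocks would need the two radii only once; the surplus serves in [block_far]. *)
Lemma position_gap m m' : 0 < m -> m < m' ->
  position m + 2 * (level m + level m') + 2 <= position m'.
Proof.
case: m => // m _; case: m' => // m'; rewrite ltnS => mm'.
have := gap_sum_mono mm'; rewrite /position /= (gap_sumS m) (gap_sumS m').
lia.
Qed.

Lemma position_level m : 0 < m -> 2 * level m < position m.
Proof. by case: m => // m _; rewrite /position gap_sumS; lia. Qed.

(** By Legendre's formula the valuation is the sum of the [m %/ 2 ^ k]. Counting the last term twice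
    makes the induction work, since twice [m %/ 2 ^ n.+1] is at most [m %/ 2 ^ n]. *)
Lemma logn2_fact_le m : logn 2 m`! <= m.
Proof.
rewrite logn_fact//.
have h n : \sum_(1 <= k < n.+1) m %/ 2 ^ k + m %/ 2 ^ n <= m.
  elim: n => [|n IH]; first by rewrite big_geq// expn0 divn1 add0n.
  rewrite big_nat_recr//= (leq_trans _ IH)// -addnA leq_add2l.
  by rewrite expnSr divnMA addnn -muln2 leq_trunc_div.
exact: leq_trans (leq_addr _ _) (h m).
Qed.

Lemma position_le m : position m <= 6 * m.
Proof.
rewrite /position /gap_sum; have := logn2_fact_le m; have := logn2_fact_le m.-1.
lia.
Qed.

Lemma level_odd_multiple j q : level (2 ^ j * (2 * q + 1)) = j.
Proof.
rewrite /level lognM ?expn_gt0 ?addn1// lognX logn_prime// muln1.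
by rewrite logn_coprime ?addn0// prime_coprime// dvdn2 /= oddM.
Qed.

(** The odd multiples [2 ^ j * (2 q + 1)] have level [j], and by [position_le] the position of the
    one with index [q] is at most [12 * 2 ^ j * (q + 1)]. *)
Lemma count_position_ge j (P : pred nat) N :
  (forall m, 0 < m -> level m = j -> P (position m)) ->
  N %/ (12 * 2 ^ j) <= count P (iota 1 N).
Proof.
move=> hP; pose m q := 2 ^ j * (2 * q + 1); set Q := N %/ _.
have m_gt0 q : 0 < m q by rewrite muln_gt0 expn_gt0 addn1.
have mI q q' : q < q' -> position (m q) < position (m q').
  move=> qq'; have : m q < m q' by rewrite ltn_pmul2l ?expn_gt0//; lia.
  by move=> /(position_gap (m_gt0 q)); lia.
rewrite -(size_iota 0 Q) -(size_map (position \o m)) -size_filter.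
apply: uniq_leq_size.
  rewrite map_inj_uniq ?iota_uniq// => q q' /= qq'.
  by have [/mI|/mI|//] := ltngtP q q'; rewrite qq' ltnn.
move=> _ /mapP[q + ->]; rewrite mem_iota /= add0n => qQ.
rewrite mem_filter hP//=; last exact: level_odd_multiple.
rewrite mem_iota add1n ltnS (leq_ltn_trans _ (position_level (m_gt0 q)))//=.
apply: leq_trans (position_le _) _.
have : Q * (12 * 2 ^ j) <= N by exact: leq_trunc_div.
by rewrite /m; nia.
Qed.

End SeparatedPositions.

Lemma position_density (R : realType) j : exists2 delta : R, 0 < delta &
  exists N0, forall N, (N0 <= N)%N -> forall P : pred nat,
    (forall m, (0 < m)%N -> level m = j -> P (position m)) ->
    delta * N%:R <= (count P (iota 1 N))%:R.
Proof.
pose D := (12 * 2 ^ j)%N.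
have D_gt0 : (0 < D)%N by rewrite muln_gt0 expn_gt0.
have D2_gt0 : (0 < 2 * D)%N by rewrite muln_gt0.
(* Halving the slope absorbs the rounding in [N %/ D] when [N >= 2 D]. *)
exists ((2 * D)%N%:R^-1); first by rewrite invr_gt0 ltr0n.
exists (2 * D)%N => N DN P /count_position_ge -/(_ N) h.
rewrite ler_pdivrMl ?ltr0n// -natrM ler_nat.
apply: (@leq_trans (2 * D * (N %/ D))%N); last by rewrite leq_mul2l h orbT.
have := ltn_ceil N D_gt0; have : (2 <= N %/ D)%N by rewrite leq_divRL.
by rewrite mulnAC; nia.
Qed.

(** Lets each term of a dense sequence, indexed by [level j.+1], be truncated at arbitrarily large
    heights. *)
Lemma infinitely_many_level (i J : nat) : exists2 j, (J <= j)%N & level j.+1 = i.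
Proof.
exists (2 ^ i * (2 * J + 1)).-1%N; last first.
  by rewrite prednK ?level_odd_multiple// muln_gt0 expn_gt0 addn1.
have : (0 < 2 ^ i)%N by rewrite expn_gt0.
nia.
Qed.

(** * Gluing measurable functions along a countable partition *)

Section Gluing.
Context d (X : measurableType d).

Lemma measurable_fun_glue d' (Y : measurableType d') (k : X -> int)
    (F : int -> X -> Y) : (forall i, measurable [set x | k x = i]) ->
  (forall i, measurable_fun setT (F i)) ->
  measurable_fun setT (fun x => F (k x) x).
Proof.
move=> mk mF _ B mB; rewrite setTI.
rewrite (_ : _ @^-1` _ = \bigcup_i ([set x | k x = i] `&` F i @^-1` B)).
  apply: countable_bigcupT_measurable => // i; apply: measurableI => //.
  by rewrite -[_ @^-1` _]setTI; exact: mF.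
apply/seteqP; split => x /=; first by move=> Bx; exists (k x).
by move=> [i _ [/= -> ]].
Qed.

Lemma scalar_measurable_glue (R : realType) (s : scalars) (k : X -> int)
    (F : int -> X -> scalar_field R s) : (forall i, measurable [set x | k x = i]) ->
  (forall i, scalar_measurable (F i)) -> scalar_measurable (fun x => F (k x) x).
Proof.
move=> mk mF; split.
- apply: (measurable_fun_glue (F := fun i => @scalar_re R s \o F i) mk) => i.
  exact: (mF i).1.
- apply: (measurable_fun_glue (F := fun i => @scalar_im R s \o F i) mk) => i.
  exact: (mF i).2.
Qed.

End Gluing.

(** * Rank, tails of the measure, and an unbounded integrable majorant *)

Section WanderingRank.
Context (R : realType) d (X : measurableType d).
Variable mu : {measure set X -> \bar R}.
Variables (p : R) (p1 : 1 <= p).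
Variables (f finv : X -> X) (W : set X).
Hypotheses (hf : nonsingular_bijection mu f finv)
  (hW : dissipative_witness mu f finv W) (mu_fin : (mu setT < +oo)%E).
Local Notation fz := (iterz f finv).
Local Notation w := (wandering_weight mu f finv W).

Let p_gt0 : 0 < p. Proof. exact: lt_le_trans p1. Qed.

(** The default 0 is never reached, since the translates of [W] cover [X]; disjointness makes the
    index unique. *)
Definition wandering_index (x : X) : int := xget 0 [set k | (fz k @` W) x].
Local Notation idx := wandering_index.

Lemma wandering_indexP x k : (fz k @` W) x <-> idx x = k.
Proof.
have [_ _ _ WT _] := hW.
have [l _ Wl] : (\bigcup_k (fz k @` W)) x by rewrite WT.
have Wi : (fz (idx x) @` W) x by apply: (@xgetPex _ 0 [set k | (fz k @` W) x]); exists l.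
split=> [Wk|<-//]; apply/eqP; apply: contrapT => /negP ik.
by have := wandering_disjoint hW ik => /seteqP[+ _] => /(_ x) []; split.
Qed.

Lemma measurable_wandering_index i : measurable [set x | idx x = i].
Proof.
rewrite (_ : [set x | _] = fz i @` W).
  by apply: (measurable_iterz_image hf); case: hW.
by apply/seteqP; split => x /= /wandering_indexP.
Qed.

Lemma wandering_index_iter n x : idx (iter n f x) = idx x + n%:Z.
Proof.
apply/wandering_indexP.
have [y Wy yx] : (fz (idx x) @` W) x by exact/wandering_indexP.
exists y => //; rewrite addrC (iterzD hf) yx.
by [].
Qed.

Definition wandering_rank (x : X) : nat := absz (idx x).
Local Notation rank := wandering_rank.

Lemma measurable_rank (P : set nat) : measurable [set x | P (rank x)].
Proof.
rewrite (_ : [set x | _] = \bigcup_i ([set x | idx x = i] `&` [set x | P (absz i)])).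
  apply: countable_bigcupT_measurable => // i; apply: measurableI.
    exact: measurable_wandering_index.
  have [Pi|Pi] := pselect (P (absz i)).
    by rewrite (_ : [set _ | _] = setT)//; apply/seteqP; split.
  by rewrite (_ : [set _ | _] = set0)//; apply/seteqP; split.
apply/seteqP; split => x /=; first by move=> Px; exists (idx x).
by move=> [i _ [/= <- ]].
Qed.

Definition rank_ge (l : nat) : set X := [set x | (l <= rank x)%N].

Lemma measurable_rank_ge l : measurable (rank_ge l).
Proof. exact: (measurable_rank [set n | (l <= n)%N]). Qed.

Definition rank_tail (l : nat) : R := fine (mu (rank_ge l)).
Local Notation t := rank_tail.

Lemma mu_fin_num (A : set X) : measurable A -> mu A \is a fin_num.
Proof.
move=> mA; rewrite ge0_fin_numE ?measure_ge0// (le_lt_trans _ mu_fin)//.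
by rewrite le_measure ?inE.
Qed.

Lemma rank_tailE l : (t l)%:E = mu (rank_ge l).
Proof. by rewrite fineK// mu_fin_num//; exact: measurable_rank_ge. Qed.

Lemma rank_tail_le l l' : (l <= l')%N -> t l' <= t l.
Proof.
move=> ll; rewrite -lee_fin !rank_tailE le_measure ?inE//;
  [exact: measurable_rank_ge|exact: measurable_rank_ge|].
by move=> x /= h; exact: leq_trans h.
Qed.

Lemma rank_tail_gt0 l : 0 < t l.
Proof.
apply: (lt_le_trans (wandering_weight_gt0 hf hW l%:Z)).
rewrite -lee_fin rank_tailE (wandering_weightE hf hW) le_measure ?inE//.
- by apply: (measurable_iterz_image hf); case: hW.
- exact: measurable_rank_ge.
- by move=> x /wandering_indexP; rewrite /rank_ge /= /rank => ->.
Qed.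

Lemma rank_tail_cvg0 e : 0 < e -> exists J, forall j, (J <= j)%N -> t j < e.
Proof.
move=> e0; have ni : nonincreasing_seq rank_ge.
  by move=> m n mn; apply/subsetPset => x /=; exact: leq_trans.
have cap0 : \bigcap_n rank_ge n = set0.
  by apply/seteqP; split => // x /(_ (rank x).+1 I); rewrite /rank_ge /= ltnn.
have := @nonincreasing_cvg_mu _ _ _ mu rank_ge _ measurable_rank_ge _ ni.
rewrite cap0 measure0 => /(_ _ measurable0) h.
have {h} : mu \o rank_ge @ \oo --> 0%E.
  by apply: h; rewrite -rank_tailE ltry.
move=> /fine_cvg/cvgr_lt/(_ _ e0)[J _ hJ].
by exists J => j Jj; exact: hJ.
Qed.

(** The exponent gives [M l ^ p = 1 / sqrt (t l)], which tends to infinity but slowly enough for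
    [M (rank x) ^ p] to be integrable. *)
Definition rank_bound (l : nat) : R := t l `^ (- (2 * p)^-1).
Local Notation M := rank_bound.

Lemma rank_bound_ge0 l : 0 <= M l. Proof. exact: powR_ge0. Qed.

Lemma rank_bound_pow l : M l `^ p = (Num.sqrt (t l))^-1.
Proof.
rewrite -powRrM mulNr invfM -mulrA mulVf ?gt_eqF// mulr1 powRN.
by rewrite -powR12_sqrt// ltW// rank_tail_gt0.
Qed.

Lemma rank_bound_le l l' : (l <= l')%N -> M l <= M l'.
Proof.
move=> ll; rewrite /M !powRN lef_pV2 ?posrE ?powR_gt0 ?rank_tail_gt0//.
rewrite ge0_ler_powR ?nnegrE ?rank_tail_le//.
- by rewrite invr_ge0 mulr_ge0// ltW.
- exact/ltW/rank_tail_gt0.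
- exact/ltW/rank_tail_gt0.
Qed.

Lemma rank_bound_unbounded a : exists J, forall j, (J <= j)%N -> a < M j.
Proof.
pose b := Num.max a 1; have b0 : 0 < b by rewrite lt_max ltr01 orbT.
(* The threshold [b ^ (- 2 p)] is the value of [t j] for which [M j] equals [b]. *)
have [J hJ] := @rank_tail_cvg0 (b `^ (- (2 * p))) (powR_gt0 _ b0).
exists J => j /hJ tj; apply: (@le_lt_trans _ _ b); first by rewrite le_max lexx.
rewrite /M powRN -[b]invrK ltf_pV2 ?posrE ?invr_gt0 ?powR_gt0 ?rank_tail_gt0//.
rewrite (_ : b^-1 = (b `^ (- (2 * p))) `^ (2 * p)^-1); last first.
  by rewrite -powRrM mulNr mulfV ?gt_eqF ?mulr_gt0// powR_inv1// ltW.
rewrite gt0_ltr_powR ?invr_gt0 ?mulr_gt0// nnegrE; last exact: powR_ge0.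
exact/ltW/rank_tail_gt0.
Qed.

Local Open Scope ereal_scope.

(** A discrete form of the integral of [1 / sqrt t]: with [a] and [b] the square roots of [t l] and
    [t l.+1], [(a ^ 2 - b ^ 2) / a <= 2 (a - b)] because [b <= a]. *)
Lemma integral_rank_shell l :
  \int[mu]_(x in [set x | rank x = l]) (M (rank x) `^ p)%:E <=
  (2 * (Num.sqrt (t l) - Num.sqrt (t l.+1)))%:E.
Proof.
have ml : measurable [set x | rank x = l] by exact: (@measurable_rank [set l]).
rewrite (eq_integral (cst ((Num.sqrt (t l))^-1)%:E)); last first.
  by move=> x; rewrite inE /= => ->; rewrite rank_bound_pow.
rewrite integral_cst//.
have -> : mu [set x | rank x = l] = (t l - t l.+1)%:E.
  have e1 : rank_ge l `\` rank_ge l.+1 = [set x | rank x = l].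
    apply/seteqP; split => x; rewrite /rank_ge /=.
      by move=> [h /negP]; rewrite -leqNgt => h'; apply/eqP; rewrite eqn_leq h h'.
    by move=> ->; rewrite leqnn ltnn; split.
  have e2 : rank_ge l `&` rank_ge l.+1 = rank_ge l.+1.
    by apply/seteqP; split => x /=; [case|move=> h; split => //; exact: ltnW].
  have fin : mu (rank_ge l) < +oo by rewrite -rank_tailE ltry.
  have : mu (rank_ge l `\` rank_ge l.+1) =
      mu (rank_ge l) - mu (rank_ge l `&` rank_ge l.+1).
    by apply: measureD => //; exact: measurable_rank_ge.
  by rewrite e1 e2 -!rank_tailE.
have t0 := rank_tail_gt0 l; have t1 := rank_tail_gt0 l.+1.
have tt := rank_tail_le (leqnSn l).
rewrite -EFinM lee_fin -[in X in (_ * (X - _) <= _)%R](sqr_sqrtr (ltW t0)).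
rewrite -[in X in (_ * (_ - X) <= _)%R](sqr_sqrtr (ltW t1)).
have : (Num.sqrt (t l.+1) <= Num.sqrt (t l))%R by rewrite ler_wsqrtr.
have : (0 < Num.sqrt (t l))%R by rewrite sqrtr_gt0.
move: (Num.sqrt (t l)) (Num.sqrt (t l.+1)) => a b a0 ba.
rewrite mulrC ler_pdivrMr// subr_sqr -mulrA mulrCA ler_wpM2l ?subr_ge0//.
lra.
Qed.

(** The bounds on the shells of rank [j + i] telescope. *)
Lemma integral_rank_ge j :
  \int[mu]_(x in rank_ge j) (M (rank x) `^ p)%:E <= (2 * Num.sqrt (t j))%:E.
Proof.
pose F i := [set x | rank x = (j + i)%N].
have mF i : measurable (F i) by exact: (@measurable_rank [set (j + i)%N]).
have DE : rank_ge j = \bigcup_i F i.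
  apply/seteqP; split => x /=; rewrite /rank_ge /F /=.
    by move=> jx; exists (rank x - j)%N => //=; rewrite subnKC.
  by move=> [i _ /= ->]; rewrite leq_addr.
have mM : measurable_fun setT (fun x => (M (rank x) `^ p)%:E).
  apply: (measurable_fun_glue (F := fun i _ => (M (absz i) `^ p)%:E)
    measurable_wandering_index) => i.
  exact: measurable_cst.
have M0 x : 0 <= (M (rank x) `^ p)%:E by rewrite lee_fin powR_ge0.
rewrite DE ge0_integral_bigcup//; last 2 first.
- exact: measurable_funTS.
- by apply/trivIsetP => a b _ _ ab; apply/seteqP; split => // x [];
    rewrite /F/= => -> /addnI/eqP; rewrite (negbTE ab).
apply: lime_le; first by apply: is_cvg_nneseries => *; exact: integral_ge0.
apply: nearW => n.
apply: (@le_trans _ _ (2 * (Num.sqrt (t j) - Num.sqrt (t (j + n))))%:E); last first.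
  by rewrite lee_fin ler_pM2l// lerBlDr lerDl sqrtr_ge0.
elim: n => [|n IH].
  by rewrite big_geq// addn0 subrr mulr0.
rewrite big_nat_recr//=; apply: le_trans (leeD IH (integral_rank_shell _)) _.
by rewrite -EFinD lee_fin addnS -mulrDr addrA subrK.
Qed.

(** Serves twice: for the glued function to lie in [Lp], and for the error along its orbit. *)
Lemma integral_dominated_by_rank (s : scalars) (phi : X -> scalar_field R s)
    (a : R) (j : nat) : scalar_measurable phi -> (0 <= a)%R ->
  (forall x, (rank x < j)%N -> phi x = 0%R) ->
  (forall x, (j <= rank x)%N -> (scalar_abs (phi x) <= a * M (rank x))%R) ->
  \int[mu]_x (scalar_abs (phi x) `^ p)%:E <= (a `^ p * (2 * Num.sqrt (t j)))%:E.
Proof.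
move=> mphi a0 phi0 phiM.
have mD := measurable_rank_ge j.
have mfp := measurable_abs_pow p mphi.
have mM : measurable_fun setT (fun x => (M (rank x) `^ p)%:E).
  apply: (measurable_fun_glue (F := fun i _ => (M (absz i) `^ p)%:E)
    measurable_wandering_index) => i.
  exact: measurable_cst.
have -> : \int[mu]_x (scalar_abs (phi x) `^ p)%:E =
    \int[mu]_(x in rank_ge j) (scalar_abs (phi x) `^ p)%:E.
  rewrite [RHS]integral_mkcond; apply: eq_integral => x _.
  rewrite patchE; case: ifPn => // /negP; rewrite inE /rank_ge /= => /negP.
  by rewrite -ltnNge => /phi0 ->; rewrite scalar_abs0 powR0// gt_eqF.
rewrite EFinM; apply: le_trans (_ : (a `^ p)%:E *
  \int[mu]_(x in rank_ge j) (M (rank x) `^ p)%:E <= _); last first.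
  by rewrite lee_wpmul2l ?lee_fin ?powR_ge0// integral_rank_ge.
rewrite -ge0_integralZl//; last 3 first.
- exact: measurable_funTS.
- by move=> x _; rewrite lee_fin powR_ge0.
- by rewrite lee_fin powR_ge0.
apply: ge0_le_integral => //.
- by move=> x _; rewrite lee_fin powR_ge0.
- exact: measurable_funTS.
- by apply: measurable_funTS; exact: measurable_funeM.
- move=> x /= jx; rewrite -EFinM lee_fin -powRM//; last exact: rank_bound_ge0.
  rewrite ge0_ler_powR ?nnegrE ?(ltW p_gt0) ?scalar_abs_ge0//.
    by rewrite mulr_ge0// rank_bound_ge0.
  exact: phiM.
Qed.

End WanderingRank.

(** * Blocks of integers around the positions *)

Definition block (k : int) : nat :=
  xget 0%N [set m | (0 < m)%N /\ (absz (k - (position m)%:Z)%R <= level m)%N].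

(** The value 0 means that [k] lies in no block, whence the positivity hypothesis. *)
Lemma blockP k : (0 < block k)%N ->
  (absz (k - (position (block k))%:Z)%R <= level (block k))%N.
Proof.
rewrite /block; case: xgetP => [m -> [] //|_].
by rewrite ltnn.
Qed.

Lemma block_origin k : (0 < block k)%N -> (level (block k) <= absz k)%N.
Proof.
move=> b0; have := blockP b0; have := position_level b0.
lia.
Qed.

Lemma block_position m k : (0 < m)%N -> (absz k <= level m)%N ->
  block (k + (position m)%:Z) = m.
Proof.
move=> m0 km; have hm : (absz (k + (position m)%:Z - (position m)%:Z)%R <= level m)%N.
  by rewrite addrK.
rewrite /block; case: xgetP => [m' _ [m'0 hm']|/(_ m)[]//].
have [mm|mm|//] := ltngtP m m'.
- have := position_gap m0 mm; lia.
- have := position_gap m'0 mm; lia.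
Qed.

(** When [k + position m] falls in the block of another [m'], the doubled separation of positions
    leaves [|k| >= level m']; for [m' = m] the hypothesis suffices. *)
Lemma block_far m k : (0 < m)%N -> (level m < absz k)%N ->
  (0 < block (k + (position m)%:Z)%R)%N ->
  (level (block (k + (position m)%:Z)%R) <= absz k)%N.
Proof.
move=> m0 km b0; have := blockP b0; set m' := block _ in b0 *.
have [mm|mm|<-] := ltngtP m m'; last by move=> _; exact: ltnW.
- have := position_gap m0 mm; lia.
- have := position_gap b0 mm; lia.
Qed.

(** * Truncation in [Lp] *)

Section Truncation.
Context (R : realType) (s : scalars) d (X : measurableType d).
Variables (mu : {measure set X -> \bar R}) (p : R) (p1 : 1 <= p).
Local Notation K := (scalar_field R s).
Local Notation Lp_fun := (Lp_fun s mu p1).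

Let p_gt0 : 0 < p. Proof. exact: lt_le_trans p1. Qed.

Lemma Lp_integrable (u : Lp_fun) :
  mu.-integrable setT (fun x => (scalar_abs (u x) `^ p)%:E).
Proof.
apply/integrableP; split; first exact/measurable_abs_pow/Lp_fun_measurable.
under eq_integral do rewrite gee0_abs ?lee_fin ?powR_ge0//.
have h : (eLp_norm mu p u <= (fine (eLp_norm mu p u))%:E)%E.
  by rewrite fineK// ge0_fin_numE ?eLp_norm_ge0// Lp_fun_lty.
rewrite eLp_norm_le ?fine_ge0 ?eLp_norm_ge0// in h.
exact: le_lt_trans h (ltry _).
Qed.

Lemma Lp_truncation (u : Lp_fun) (a : R) : exists psi : Lp_fun,
  forall x, psi x = if scalar_abs (u x) <= a then u x else 0.
Proof.
pose A := [set x | scalar_abs (u x) <= a].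
have mu_ := Lp_fun_measurable u.
have mA : measurable A.
  have := scalar_measurable_abs mu_ measurableT (measurable_itv `]-oo, a]).
  by rewrite setTI; congr measurable; apply/seteqP; split => x /=;
    rewrite in_itv.
pose psi x : K := if x \in A then u x else 0.
have mpsi : scalar_measurable psi.
  exact: (@scalar_measurable_ite R s d X A u (cst 0) mA mu_ (scalar_measurable_cst _ 0)).
have h : psi \in Lp_fun_pred mu p1.
  apply/Lp_fun_predP; split=> //; apply: le_lt_trans (Lp_fun_lty u).
  apply: le_Lnorm => //.
  - exact: scalar_measurable_abs.
  - exact: scalar_measurable_abs.
  - by move=> x; exact: scalar_abs_ge0.
  - move=> x; rewrite /psi /=; case: ifP => // _.
    by rewrite scalar_abs0 scalar_abs_ge0.
exists (LpFun h) => x /=; rewrite /psi.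
by have -> : (x \in A) = (scalar_abs (u x) <= a) by apply/idP/idP; rewrite inE.
Qed.

(** Dominated convergence: the [p]-th power of the error is at most that of [u], and vanishes at [x]
    once [M j] exceeds the modulus of [u x]. *)
Lemma Lp_truncation_cvg (u : Lp_fun) (M : nat -> R) (e : R) :
  (forall a, exists J, forall j, (J <= j)%N -> a < M j) -> 0 < e ->
  exists J, forall j (psi : Lp_fun), (J <= j)%N ->
    (forall x, psi x = if scalar_abs (u x) <= M j then u x else 0) ->
    Lp_norm (Lp_class psi - Lp_class u) <= e.
Proof.
move=> hM e0.
have [psi hpsi] : exists psi : nat -> Lp_fun, forall j x,
    psi j x = if scalar_abs (u x) <= M j then u x else 0.
  have /choice[psi hpsi] j := Lp_truncation u (M j).
  by exists psi.
pose g j x := ((scalar_abs (psi j x - u x)) `^ p)%:E.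
have mg j : measurable_fun setT (g j).
  exact/measurable_abs_pow/(Lp_fun_measurable (psi j - u)).
have [_ _] : [/\ mu.-integrable setT (cst 0%E : X -> \bar R),
    (\int[mu]_x `|g j x - cst 0%E x|)%E @[j --> \oo] --> 0%E &
    (\int[mu]_x g j x)%E @[j --> \oo] --> (\int[mu]_x (cst 0%E x))%E].
  apply: (dominated_convergence measurableT mg _ _ (Lp_integrable u)) => //.
  - apply: aeW => x _; apply: cvg_near_cst.
    have [J hJ] := hM (scalar_abs (u x)).
    exists J => // j /= /hJ /ltW uM.
    by rewrite /g hpsi uM subrr scalar_abs0 powR0// gt_eqF.
  - apply: aeW => x j _; rewrite /g gee0_abs ?lee_fin ?powR_ge0//.
    rewrite ge0_ler_powR ?nnegrE ?(ltW p_gt0) ?scalar_abs_ge0// hpsi.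
    case: ifP => _; first by rewrite subrr scalar_abs0 scalar_abs_ge0.
    by rewrite sub0r scalar_absN.
rewrite integral0 => h.
have ep : 0 < e `^ p by rewrite powR_gt0.
have /h[J _ hJ] : nbhs (0%E : \bar R) [set y | (y < (e `^ p)%:E)%E].
  by apply: open_nbhs_nbhs; split; [exact: open_ereal_lt_ereal|rewrite /= lte_fin].
exists J => j psi' Jj hpsi'.
rewrite -lee_fin Lp_classB Lp_normE eLp_norm_le ?(ltW e0)//.
apply/ltW; apply: le_lt_trans (hJ j Jj); rewrite le_eqVlt; apply/orP; left.
apply/eqP; apply: eq_integral => x _; rewrite /g hpsi -hpsi'.
by [].
Qed.

End Truncation.

(** * A frequently hypercyclic vector when the measure is finite *)

Section FrequentlyHypercyclicVector.
Context (R : realType) (s : scalars) d (X : measurableType d).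
Variables (mu : {measure set X -> \bar R}) (p : R) (p1 : 1 <= p).
Variables (f finv : X -> X) (W : set X).
Hypotheses (hf : nonsingular_bijection mu f finv)
  (hW : dissipative_witness mu f finv W) (mu_fin : (mu setT < +oo)%E).
Local Notation K := (scalar_field R s).
Local Notation Lp_fun := (Lp_fun s mu p1).
Local Notation Lp := (Lp s mu p1).
Local Notation T := (comp_op s p1 hf).
Local Notation fz := (iterz f finv).
Local Notation idx := (wandering_index f finv W).
Local Notation rank := (wandering_rank f finv W).
Local Notation M := (rank_bound mu p f finv W).
Local Notation t := (rank_tail mu f finv W).

Let p_gt0 : 0 < p. Proof. exact: lt_le_trans p1. Qed.

Section BlockSum.
Variable psi : nat -> Lp_fun.
Hypothesis psi_bound : forall j x, scalar_abs (psi j x) <= M j.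

(** As blocks are disjoint, this is the sum of the copies of [psi (level m)] moved to time
    [position m], each cut down to its block. *)
Definition block_sum (x : X) : K :=
  let m := block (idx x) in
  if m == 0%N then 0 else psi (level m) (fz (- (position m)%:Z) x).

Lemma block_sum_measurable : scalar_measurable block_sum.
Proof.
apply: (scalar_measurable_glue (F := fun k x => if block k == 0%N then 0 else
   psi (level (block k)) (fz (- (position (block k))%:Z) x))
   (measurable_wandering_index hf hW)) => k.
case: (block k == 0%N); first exact: (scalar_measurable_cst _ 0).
apply: (@scalar_measurable_comp _ _ _ _ (psi _) (fz _)).
  exact: (measurable_iterz hf).
exact: Lp_fun_measurable.
Qed.

Lemma block_sum_bound x l : (0 < block (idx x))%N ->
  (level (block (idx x)) <= l)%N -> scalar_abs (block_sum x) <= M l.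
Proof.
move=> b0 bl; rewrite /block_sum gtn_eqF//; apply: le_trans (psi_bound _ _) _.
exact: (rank_bound_le p1 hf hW mu_fin).
Qed.

Lemma block_sum_le x : scalar_abs (block_sum x) <= M (rank x).
Proof.
have [b0|b0] := posnP (block (idx x)).
  by rewrite /block_sum b0 eqxx scalar_abs0 rank_bound_ge0.
by apply: block_sum_bound => //; exact: block_origin.
Qed.

Lemma block_sum_near m x : (0 < m)%N -> (rank x <= level m)%N ->
  block_sum (iter (position m) f x) = psi (level m) x.
Proof.
move=> m0 xm; rewrite /block_sum (wandering_index_iter hf hW).
rewrite block_position// gtn_eqF//; congr (psi _ _).
exact: (iterzK hf (position m)%:Z).
Qed.

Lemma block_sum_far m x : (0 < m)%N -> (level m < rank x)%N ->
  scalar_abs (block_sum (iter (position m) f x)) <= M (rank x).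
Proof.
move=> m0 xm; set y := iter _ _ _.
have yE : idx y = idx x + (position m)%:Z by exact: (wandering_index_iter hf hW).
have [b0|b0] := posnP (block (idx y)).
  by rewrite /block_sum b0 eqxx scalar_abs0 rank_bound_ge0.
apply: block_sum_bound => //; rewrite yE block_far// -yE.
by [].
Qed.

Lemma block_sum_Lp : block_sum \in Lp_fun_pred mu p1.
Proof.
apply/Lp_fun_predP; split; first exact: block_sum_measurable.
apply: eLp_norm_lty; apply: le_lt_trans (ltry _).
apply: (integral_dominated_by_rank p1 hf hW mu_fin (a := 1) (j := 0)) => //.
  exact: block_sum_measurable.
by move=> x _; rewrite mul1r block_sum_le.
Qed.

Definition block_vector : Lp := Lp_class (LpFun block_sum_Lp).

(** At time [position m] the difference vanishes up to rank [j = level m]; beyond, both terms are at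
    most [M (rank x)], hence the factor 2 and the tail from [j.+1]. *)
Lemma block_vector_orbit e : 0 < e -> exists J, forall m, (0 < m)%N ->
  (J <= level m)%N ->
  Lp_norm (iter (position m) T block_vector - Lp_class (psi (level m))) <= e.
Proof.
move=> e0; pose c := 2 `^ p * 2; have c0 : 0 < c by rewrite mulr_gt0// powR_gt0.
(* The squared threshold makes the integral bound [c * sqrt (t j.+1)] at most [e ^ p]. *)
have [J hJ] : exists J, forall j, (J <= j)%N -> t j < (e `^ p / c) ^+ 2.
  apply: (rank_tail_cvg0 hf hW mu_fin).
  by rewrite exprn_gt0// divr_gt0// powR_gt0.
exists J => m m0 Jm; set j := level m in Jm *.
have [phi -> phiE] := iter_comp_opE hf (LpFun block_sum_Lp) (position m).
have {}phiE x : phi x = block_sum (iter (position m) f x) by exact: phiE.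
rewrite -lee_fin Lp_classB Lp_normE (eLp_norm_le _ p1) ?(ltW e0)//.
apply: le_trans (integral_dominated_by_rank p1 hf hW mu_fin (a := 2) (j := j.+1)
   (Lp_fun_measurable _) _ _ _) _ => //.
- move=> x; rewrite ltnS => xj; rewrite [LHS](_ : _ = phi x - psi j x)//.
  by rewrite phiE block_sum_near// subrr.
- move=> x jx; rewrite [X in scalar_abs X](_ : _ = phi x - psi j x)//.
  apply: le_trans (scalar_absD _ _) _; rewrite scalar_absN mulr_natl mulr2n.
  rewrite lerD//; first by rewrite phiE block_sum_far.
  apply: le_trans (psi_bound _ _) _.
  by apply: (rank_bound_le p1 hf hW mu_fin); exact: ltnW.
- rewrite lee_fin mulrA -/c mulrC -ler_pdivlMr//.
  have h : 0 <= e `^ p / c by rewrite divr_ge0 ?powR_ge0// ltW.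
  rewrite -[leRHS](ger0_norm h) -sqrtr_sqr ler_wsqrtr//.
  by apply/ltW/hJ; exact: leqW.
Qed.

End BlockSum.

Lemma finite_measure_frequently_hypercyclic :
  separable Lp -> frequently_hypercyclic R T.
Proof.
move=> [D cD dD].
have [u hu] : exists u : nat -> Lp_fun, forall v, D v -> exists i, Lp_class (u i) = v.
  have /countable_injP[g gI] := cD.
  (* The injection [g] numbers the dense set; indices that it does not use get the vector 0. *)
  exists (fun i => repr (xget (0 : Lp) [set v | D v /\ g v = i])) => v Dv.
  exists (g v); rewrite Lp_reprK; case: xgetP => [v' _ [Dv' gv]|/(_ v) []//].
  by apply: gI; rewrite ?inE.
have [psi hpsi] : exists psi : nat -> Lp_fun, forall j x, psi j x =
    if scalar_abs (u (level j.+1) x) <= M j then u (level j.+1) x else 0.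
  have /choice[psi hpsi] j := Lp_truncation (u (level j.+1)) (M j).
  by exists psi.
have psi_bound j x : scalar_abs (psi j x) <= M j.
  by rewrite hpsi; case: ifP => // _; rewrite scalar_abs0 rank_bound_ge0.
exists (block_vector psi_bound) => U oU U0.
have [v [Uv /hu[i iv]]] := dD U U0 oU.
have /nbhs_Lp[e e0 eU] : nbhs v U by exact: open_nbhs_nbhs.
have e3 : 0 < e / 3 by rewrite divr_gt0.
have [J1 hJ1] := Lp_truncation_cvg (u i) (rank_bound_unbounded p1 hf hW mu_fin) e3.
have [J2 hJ2] := block_vector_orbit psi_bound e3.
(* Among the indices [j] carrying a truncation of [u i], one is fixed so large that the truncation
   error and the orbit error are each at most [e / 3]. *)
have [j Jj ji] := infinitely_many_level i (maxn J1 J2).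
move: Jj; rewrite geq_max => /andP[J1j J2j].
apply/lower_visit_density_gt0.
have [delta d0 [N0 h]] := position_density R j.
exists delta => //; exists N0 => N N0N; apply: h => // m m0 mj.
rewrite inE; apply: eU; apply: le_lt_trans (Lp_distD (Lp_class (psi j)) _ _) _.
have h1 : Lp_norm (Lp_class (psi j) - v) <= e / 3.
  by rewrite -iv; apply: (hJ1 j) => // x; rewrite hpsi ji.
have := hJ2 m m0; rewrite mj => /(_ J2j) h2.
apply: le_lt_trans (lerD h2 h1) _.
by rewrite -mulrDl ltr_pdivrMr// mulr_natr mulrSr mulr2n ltrDl.
Qed.

End FrequentlyHypercyclicVector.

(** * The equivalence, by way of finiteness of the measure *)

Theorem theorem2p9 (R : realType) (s : scalars) (d : measure_display)
    (X : measurableType d) (mu : {sigma_finite_measure set X -> \bar R})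
    (p : R) (p1 : 1 <= p) (f finv : X -> X)
    (hf : nonsingular_bijection mu f finv) :
  separable (Lp s mu p1) ->
  dissipative_bounded_distortion mu f finv ->
  frequently_recurrent R (comp_op s p1 hf) <->
  frequently_hypercyclic R (comp_op s p1 hf).
Proof.
move=> sep [W hW hD]; split; last exact: frequently_hypercyclic_recurrent.
move=> /(frequently_recurrent_weights hW hD)[B hB].
have mu_fin := finite_measure_weights hf hW hB.
exact: (finite_measure_frequently_hypercyclic hf hW mu_fin sep).
Qed.
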